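(* Let $T>0$, $\alpha\in(0,1)$, $p>1/\alpha$, and let $U,\rho,f,g$ satisfy assumptions (A1)-(A3) listed in the context. For $x_0\in\mathbb R^n$ and $u(\cdot)\in\mathcal U^p[0,T]$ consider $$x(t)=x_0+\int_0^t\frac{f(t,s,x(s),u(s))}{(t-s)^{1-\alpha}}\,\mathrm ds+\int_0^t g(t,s,x(s),u(s))\,\mathrm ds,\quad\text{a.e. }t\in[0,T].\qquad(\ast)$$ Then: (i) For any $(x_0,u(\cdot))\in\mathbb R^n\times\mathcal U^p[0,T]$, equation $(\ast)$ admits a unique solution $x(\cdot;x_0,u)$ in $C([0,T];\mathbb R^n)$, and there is a constant $C\ge0$ such that $$\|x(\cdot;x_0,u)\|_{L^p([0,T];\mathbb R^n)}\le C\bigl(1+|x_0|+\|\rho(u(\cdot),u_0)\|_{L^p([0,T];\mathbb R_+)}\bigr).$$ (ii) For any $x_0,x_0'\in\mathbb R^n$ and $u(\cdot),u'(\cdot)\in\mathcal U^p[0,T]$, there is a constant $C\ge0$ such that $$\|x(\cdot;x_0,u)-x(\cdot;x_0',u')\|_{L^p([0,T];\mathbb R^n)}\le C|x_0-x_0'|$$ $$+C\Bigl[\int_0^T\Bigl(\int_0^t\frac{|f(t,s,x(s;x_0,u),u(s))-f(t,s,x(s;x_0,u),u'(s))|}{(t-s)^{1-\alpha}}\,\mathrm ds\Bigr)^p\mathrm dt\Bigr]^{1/p}$$ $$+C\Bigl[\int_0^T\Bigl(\int_0^t|g(t,s,x(s;x_0,u),u(s))-g(t,s,x(s;x_0,u),u'(s))|\,\mathrm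 ds\Bigr)^p\mathrm dt\Bigr]^{1/p}.$$
   Context: $\Delta:=\{(t,s)\in[0,T]^2:0\le s\le t\le T\}$. A modulus of continuity is an increasing function $\omega:[0,\infty)\to[0,\infty)$ vanishing at $0$ and continuous at $0$. $L^{q+}:=\bigcup_{r>q}L^r$ for $1\le q<\infty$. For a fixed $u_0\in U$, $\mathcal U^p[0,T]$ is the set of measurable $u:[0,T]\to U$ with $\rho(u(\cdot),u_0)\in L^p([0,T];\mathbb R_+)$. The functions $f,g:\Delta\times\mathbb R^n\times U\to\mathbb R^n$ are measurable so that the integrals are meaningful. (A1) $U\subset\mathbb R^d$ and $(U,\rho)$ is a separable metric space with $\rho(u,u')=|u-u'|$. (A2) There are a constant $K\ge0$ and a modulus of continuity $\omega$ with $|f(t,s,x,u)-f(t',s,x,u)|+|g(t,s,x,u)-g(t',s,x,u)|\le K\omega(|t-t'|)(1+|x|)$ for all $(t,s),(t',s)\in\Delta$, $x\in\mathbb R^n$, $u\in U$. (A3) $p>1/\alpha$ and there are nonnegative functions $K_0(\cdot)\in L^{\frac1\alpha+}([0,T];\mathbb R)$ and $K(\cdot)\in L^{\frac{p}{\alpha p-1}+}([0,T];\mathbb R)$ with $|f(t,s,x,u)-f(t,s,x',u')|+|g(t,s,x,u)-g(t,s,x',u')|\le K(s)(|x-x'|+\rho(u,u'))$ for all $(t,s)\in\Delta$, $x,x'\in\mathbb R^n$, $u,u'\in U$, and $|f(t,s,0,u)|+|g(t,s,0,u)|\le K_0(s)$ for all $(t,s)\in\Delta$, $u\in U$. *)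

(* Defs.v *)
From mathcomp Require Import all_boot all_order all_algebra.
From mathcomp Require Import all_classical all_reals all_analysis.
Set Implicit Arguments.
Unset Strict Implicit.
Unset Printing Implicit Defensive.
Import Order.TTheory GRing.Theory Num.Theory.
Import numFieldNormedType.Exports.
Local Open Scope classical_set_scope.
Local Open Scope ring_scope.

(* [measurable_fun D f] holds vacuously when D is not measurable.  Here D is
   measurable only if U is, and U is an arbitrary subset of R^d, so
   measurability on D is taken with respect to the trace sigma-algebra. *)
Definition trace_measurable_fun d1 d2 (X : measurableType d1)
    (Y : measurableType d2) (D : set X) (h : X -> Y) : Prop :=
  forall B : set Y, measurable B ->
    exists2 A : set X, measurable A & D `&` h @^-1` B = D `&` A.

Section Volterra.
Context {R : realType}.

(* The library puts the Borel sigma-algebra on R; measurability in time and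
   integrals in time are meant in the sense of Lebesgue, i.e. with respect to
   the completion. *)
Notation leb := (@completed_lebesgue_measure R).

Definition lebR :=
  caratheodory_type (mu_ext (wlength (@idfun R) : {measure set _ -> \bar R})).

Definition borel_rV (m : nat) := g_sigma_algebraType (@open 'rV[R]_m).

(* Euclidean norm (the library norm on 'rV[R]_m is the sup norm). *)
Definition enorm (m : nat) (x : 'rV[R]_m) : R :=
  Num.sqrt (\sum_(i < m) x ord0 i ^+ 2).

Definition memLp (T r : R) (h : R -> R) : Prop :=
  (h \_ `[0, T] : lebR -> R) \in Lfun leb r%:E.

Definition Lpnorm (T r : R) (h : R -> R) : \bar R :=
  Lnorm leb r%:E (EFin \o (h \_ `[0, T])%R).

Definition memLplus (T q : R) (h : R -> R) : Prop :=
  exists2 r : R, q < r & memLp T r h.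

Definition vintegrable (m : nat) (D : set R) (h : R -> 'rV[R]_m) : Prop :=
  forall i, leb.-integrable D (fun s : R => (h s ord0 i)%:E).

Definition vintegral (m : nat) (D : set R) (h : R -> 'rV[R]_m) : 'rV[R]_m :=
  \row_i Rintegral leb D (fun s : R => h s ord0 i).

Definition Delta (T : R) : set (R * R) :=
  [set z | [/\ 0 <= z.2, z.2 <= z.1 & z.1 <= T]].

(* Only the values on [0, +oo[ matter. *)
Definition modulus_of_continuity (omega : R -> R) : Prop :=
  [/\ forall r : R, 0 <= r -> 0 <= omega r,
      forall r r' : R, 0 <= r -> r <= r' -> omega r <= omega r',
      omega 0 = 0 &
      omega r @[r --> 0^'+] --> (0 : R)].

Section Data.
Context {n d : nat}.
Implicit Types (U : set 'rV[R]_d) (rho : 'rV[R]_d -> 'rV[R]_d -> R)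
  (f g : R -> R -> 'rV[R]_n -> 'rV[R]_d -> 'rV[R]_n)
  (u : R -> 'rV[R]_d) (x : R -> 'rV[R]_n).

(* The fields are functions of (t, s, x, u), Lebesgue in the times t, s and
   Borel in x and u. *)
Definition measurable_field (T : R) U f : Prop :=
  @trace_measurable_fun _ _ ((lebR * lebR) * (borel_rV n * borel_rV d))%type
    (borel_rV n)
    [set z | Delta T z.1 /\ U z.2.2]
    (fun z => f z.1.1 z.1.2 z.2.1 z.2.2).

Definition separable_for U rho : Prop :=
  exists S : set 'rV[R]_d, [/\ countable S, S `<=` U &
    forall (v : 'rV[R]_d) (e : R), U v -> 0 < e -> exists2 w, S w & rho v w < e].

Definition A1 U rho : Prop :=
  (forall v v', U v -> U v' -> rho v v' = enorm (v - v')) /\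
  separable_for U rho.

Definition A2 (T : R) U f g : Prop :=
  exists (K : R) (omega : R -> R), [/\ 0 <= K, modulus_of_continuity omega &
    forall (t t' s : R) (x : 'rV[R]_n) (u : 'rV[R]_d),
      Delta T (t, s) -> Delta T (t', s) -> U u ->
      enorm (f t s x u - f t' s x u) + enorm (g t s x u - g t' s x u)
        <= K * omega `|t - t'| * (1 + enorm x)].

Definition A3 (T alpha p : R) U rho f g : Prop :=
  p > 1 / alpha /\
  exists K0 K : R -> R,
    [/\ (forall s : R, 0 <= s <= T -> 0 <= K0 s /\ 0 <= K s),
        memLplus T (1 / alpha) K0,
        memLplus T (p / (alpha * p - 1)) K,
        (forall (t s : R) (x x' : 'rV[R]_n) (u u' : 'rV[R]_d),
           Delta T (t, s) -> U u -> U u' ->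
           enorm (f t s x u - f t s x' u') + enorm (g t s x u - g t s x' u')
             <= K s * (enorm (x - x') + rho u u')) &
        (forall (t s : R) (u : 'rV[R]_d), Delta T (t, s) -> U u ->
           enorm (f t s 0 u) + enorm (g t s 0 u) <= K0 s)].

(* Functions on [0, T] are represented by functions on R whose values outside
   [0, T] are irrelevant. *)
Definition admissible (T p : R) U rho (u0 : 'rV[R]_d) : set (R -> 'rV[R]_d) :=
  [set u | [/\ forall t : R, 0 <= t <= T -> U (u t),
      measurable_fun (`[0, T] : set lebR) (u : lebR -> borel_rV d) &
      memLp T p (fun t => rho (u t) u0)]].

Definition singular_integrand (alpha : R) f x u (t s : R) : 'rV[R]_n :=
  ((t - s) `^ (1 - alpha))^-1 *: f t s (x s) (u s).

Definition regular_integrand g x u (t s : R) : 'rV[R]_n := g t s (x s) (u s).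

Definition satisfies_equation (alpha : R) f g (x0 : 'rV[R]_n) u x (t : R) :=
  [/\ vintegrable `[0, t] (singular_integrand alpha f x u t),
      vintegrable `[0, t] (regular_integrand g x u t) &
      x t = x0 + vintegral `[0, t] (singular_integrand alpha f x u t)
               + vintegral `[0, t] (regular_integrand g x u t)].

Definition is_solution (T alpha : R) f g (x0 : 'rV[R]_n) u x : Prop :=
  {within `[0, T], continuous x} /\
  {ae leb, forall t : R, 0 <= t <= T -> satisfies_equation alpha f g x0 u x t}.

Definition singular_gap (T alpha p : R) f x u u' : \bar R :=
  ((\int[leb]_(t in `[0%R, T])
     (\int[leb]_(s in `[0%R, t])
        (enorm (f t s (x s) (u s) - f t s (x s) (u' s))
           / (t - s) `^ (1 - alpha))%R%:E) `^ p) `^ p^-1)%E.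

Definition regular_gap (T p : R) g x u u' : \bar R :=
  ((\int[leb]_(t in `[0%R, T])
     (\int[leb]_(s in `[0%R, t])
        (enorm (g t s (x s) (u s) - g t s (x s) (u' s)))%:E) `^ p)
   `^ p^-1)%E.

End Data.
End Volterra.

(* Main.v *)
Require Import Defs.
From mathcomp Require Import all_boot all_order all_algebra.
From mathcomp Require Import all_classical all_reals all_analysis.
From mathcomp Require Import measurable_realfun ring lra.
Set Implicit Arguments.
Unset Strict Implicit.
Unset Printing Implicit Defensive.
Import Order.TTheory GRing.Theory Num.Theory.
Import numFieldNormedType.Exports.
Local Open Scope classical_set_scope.
Local Open Scope ring_scope.

(** The regular integral is the case theta = 1 of the kernel (t - s)^(theta - 1), so one family of
    estimates serves both integrals. The core is an inequality between p-th powers. If K lies in L^r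
    with r > p / (alpha p - 1), then 1/r + 1/p < alpha, so the exponent q with 1/p + 1/q + 1/r = 1
    satisfies (1 - alpha) q < 1 and the kernel is bounded in L^q(0, t) uniformly in t. Hoelder with
    three factors ([kernel_hoelder]) bounds the p-th power of the integral of (t - s)^(alpha - 1) K
    w over [0, t] by B times the integral of w^p. A singular linear inequality for w with forcing a
    thus becomes w(t)^p <= B a(t)^p + B int_0^t w^p ([volterra_power_bound]), and the classical
    [gronwall] applies to w^p; the outcome is [Lp_gronwall].

    Existence is by Picard iteration. The right-hand side of the equation maps continuous paths to
    continuous paths ([volterra_modulus], [continuous_volterra_map]): along a path bounded by X the
    fields are dominated by K0 + K X, which lies in L^r' for some r' > 1/alpha, so the conjugate
    exponent keeps the kernel integrable, and (A2) controls the variation in t. By the power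
    inequality the p-th powers of successive differences are at most a constant times 2^-k exp(2 B
    t), so the iterates converge uniformly to a fixed point.

    For stability take w = |x - x'| and a = |x0 - x0'| plus the two gaps, the difference of the
    fields being split at f(t, s, x(s), u'(s)) ([volterra_diff]). Equal data give a = 0, so two
    solutions agree almost everywhere and, being continuous, everywhere. For the growth bound take w
    = |x| and for a a constant multiple of 1 + |x0| that absorbs the integrals of the kernels
    against K0. *)

Local Notation leb := completed_lebesgue_measure.

(** * Borel and Lebesgue measurability on the line *)

Lemma Borel_lebR (R : realType) (A : set R) :
  measurable (A : set (measurableTypeR R)) -> measurable (A : set (@lebR R)).
Proof. exact: sub_caratheodory. Qed.

Lemma measurable_itv_lebR (R : realType) (i : interval R) :
  measurable ([set` i] : set (@lebR R)).
Proof. by apply: Borel_lebR; exact: measurable_itv. Qed.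
#[local] Hint Resolve measurable_itv_lebR : core.

Lemma Borel_lebR_fun (R : realType) d (Y : measurableType d) (D : set R)
    (h : R -> Y) : measurable (D : set (measurableTypeR R)) ->
  measurable_fun (D : set (measurableTypeR R)) h ->
  measurable_fun (D : set (@lebR R)) h.
Proof. by move=> mD mh _ B mB; apply: Borel_lebR; exact: mh. Qed.

(** The Borel Lebesgue measure is the image of its completion under the identity, so the change of
    variables formula identifies the two integrals of a Borel function. *)
Lemma ge0_integral_leb (R : realType) (D : set R) (h : R -> R) :
  measurable D -> measurable_fun D h -> (forall x, D x -> 0 <= h x) ->
  (\int[leb]_(x in D) (h x)%:E = \int[lebesgue_measure]_(x in D) (h x)%:E)%E.
Proof.
move=> mD mh h0.
have mid : measurable_fun [set: @lebR R] (id : @lebR R -> measurableTypeR R).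
  by move=> _ B mB; rewrite setTI; exact: Borel_lebR.
have -> : (\int[lebesgue_measure]_(x in D) (h x)%:E =
   \int[pushforward leb (id : @lebR R -> measurableTypeR R)]_(x in D) (h x)%:E)%E.
  exact: eq_measure_integral.
rewrite (ge0_integral_pushforward mid)//.
  exact: (measurableT_comp (@measurable_realfun.EFin_measurable _ setT) mh).
by move=> x /set_mem Dx; rewrite lee_fin; exact: h0.
Qed.

Lemma leb_itvcc (R : realType) (a b : R) : a <= b ->
  leb (`[a, b] : set R) = (b - a)%:E.
Proof.
move=> ab; transitivity (lebesgue_measure (`[a, b] : set R)) => //.
rewrite lebesgue_measure_itv/= lte_fin; case: ltgtP ab => // -[-> _].
by rewrite subrr.
Qed.

(** * Explicit integrals of exponentials and of powers *)

Lemma is_derive_powR_opp (R : realType) (t c s : R) : s < t ->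
  is_derive s (1 : R) (fun x => - ((t - x) `^ c)) (c * (t - s) `^ (c - 1)).
Proof.
move=> st.
have ts : 0 < t - s by rewrite subr_gt0.
have h : is_derive s (1 : R) (fun x : R => t - x) (-1).
  have := is_deriveB (is_derive_cst t s 1) (is_derive_id s (1 : R)).
  by rewrite sub0r.
have p := is_derive1_powR c ts.
have := is_deriveN (is_derive1_comp (f := fun x => x `^ c) (g := fun x : R => t - x) p h).
by rewrite mulrN1 opprK.
Qed.

Lemma integral_leb_derive (R : realType) (a b : R) (f F : R -> R) : a <= b ->
  (forall s, a <= s <= b -> is_derive s (1 : R) F (f s)) ->
  (forall s, a <= s <= b -> {for s, continuous f}) ->
  (forall s, a <= s <= b -> 0 <= f s) ->
  (\int[leb]_(s in `[a, b]) (f s)%:E = (F b - F a)%:E)%E.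
Proof.
move=> ab dF cf f0.
have cfw : {within `[a, b], continuous f}.
  by apply: continuous_in_subspaceT => s /set_mem/=; rewrite in_itv; exact: cf.
rewrite ge0_integral_leb; last 3 first.
- exact: measurable_itv.
- exact: subspace_continuous_measurable_fun.
- by move=> s/=; rewrite in_itv => /f0.
move: ab; rewrite le_eqVlt => /predU1P[<-|ab].
  by rewrite set_itv1 integral_set1 subrr.
rewrite (continuous_FTC2 (F := F) ab cfw) ?EFinB//.
- split.
  + move=> s; rewrite in_itv/= => /andP[/ltW as_ /ltW sb].
    have sab : a <= s <= b by rewrite as_.
    by have [] := dF s sab.
  + apply: cvg_at_right_filter; apply: differentiable_continuous.
    by apply/derivable1_diffP; have [|//] := dF a; rewrite lexx ltW.
  + apply: cvg_at_left_filter; apply: differentiable_continuous.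
    by apply/derivable1_diffP; have [|//] := dF b; rewrite lexx ltW.
- move=> s; rewrite in_itv/= => /andP[/ltW as_ /ltW sb].
  have sab : a <= s <= b by rewrite as_.
  by rewrite derive1E; have [] := dF s sab.
Qed.

Lemma integral_expR (R : realType) (l t : R) : 0 < l -> 0 <= t ->
  (\int[leb]_(s in `[0%R, t]) (expR (l * s))%:E = ((expR (l * t) - 1) / l)%:E)%E.
Proof.
move=> l0 t0.
have -> : (expR (l * t) - 1) / l = l^-1 * expR (l * t) - l^-1 * expR (l * 0).
  by rewrite mulr0 expR0 -mulrBr mulrC.
apply: (@integral_leb_derive _ _ _ _ (fun s => l^-1 * expR (l * s))) => //.
- move=> s _.
  have dl : is_derive s (1 : R) (fun x : R => l * x) l.
    by have := is_deriveZ l (is_derive_id s (1 : R)); rewrite /GRing.scale/= mulr1.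
  have := is_derive1_comp (f := expR) (is_derive_expR (l * s)) dl.
  move=> /(is_deriveZ l^-1) h; apply: (is_derive_eq h).
  by rewrite /GRing.scale/= mulrCA mulVf ?mulr1 ?gt_eqF.
- move=> s _; apply: continuous_comp; last exact: continuous_expR.
  by apply: continuousM => //; exact: cst_continuous.
Qed.

Lemma integral_powR_lt (R : realType) (a b t c : R) : a <= b -> b < t -> 0 < c ->
  (\int[leb]_(s in `[a, b]) ((t - s) `^ (c - 1))%:E
   = (((t - a) `^ c - (t - b) `^ c) / c)%:E)%E.
Proof.
move=> ab bt c0.
have dF s e : a <= s <= b ->
    is_derive s (1 : R) (fun x => - ((t - x) `^ e)) (e * (t - s) `^ (e - 1)).
  by move=> /andP[_ sb]; apply: is_derive_powR_opp; exact: le_lt_trans bt.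
have -> : ((t - a) `^ c - (t - b) `^ c) / c =
    c^-1 * - ((t - b) `^ c) - c^-1 * - ((t - a) `^ c).
  by rewrite -mulrBr opprK addrC mulrC.
apply: (@integral_leb_derive _ _ _ _ (fun s => c^-1 * - ((t - s) `^ c))) => //.
- move=> s sab; have /(is_deriveZ c^-1) h := dF s c sab.
  apply: (is_derive_eq h).
  by rewrite /GRing.scale/= mulKf ?gt_eqF.
- move=> s sab; apply: differentiable_continuous; apply/derivable1_diffP.
  have [+ _] := dF s (c - 1) sab.
  move=> /derivableN.
  by rewrite (_ : - _ = fun x => (t - x) `^ (c - 1))//; apply/funext => x /=; rewrite !fctE opprK.
- by move=> s _; exact: powR_ge0.
Qed.

(** The bound persists at the singular endpoint b = t: there it follows from the case b < t by
    monotone convergence. *)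
Lemma integral_powR_le (R : realType) (a b t c : R) : a <= b -> b <= t -> 0 < c ->
  (\int[leb]_(s in `[a, b]) ((t - s) `^ (c - 1))%:E
   <= (((t - a) `^ c - (t - b) `^ c) / c)%:E)%E.
Proof.
move=> ab; rewrite le_eqVlt => /predU1P[<-{t}|bt] c0; last first.
  by rewrite integral_powR_lt.
rewrite subrr (@powR0 _ c) ?gt_eqF// subr0.
have m1 : measurable_fun (setT : set R) (fun s : R => (b - s) `^ (c - 1)).
  apply: (measurableT_comp (measurable_powR _)).
  exact: measurable_funB.
have m1e D : measurable_fun (D : set R) (fun s : R => ((b - s) `^ (c - 1))%:E).
  exact: measurable_funTS (measurableT_comp _ m1).
rewrite ge0_integral_leb; last 3 first.
- exact: measurable_itv.
- exact: measurable_funTS.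
- by move=> s _; exact: powR_ge0.
move: ab; rewrite le_eqVlt => /predU1P[<-|ab].
  by rewrite set_itv1 integral_set1 lee_fin divr_ge0 ?powR_ge0// ltW.
rewrite -integral_itv_bndo_bndc//.
have ba : 0 < b - a by rewrite subr_gt0.
(* These compact intervals stop short of the singularity and increase to [[a, b[]. *)
pose F n : set R := `[a, b - (b - a) / n.+1%:R]%classic.
have -> : `[a, b[%classic = \bigcup_n F n.
  apply/seteqP; split => [s|s [n _]]; rewrite /F/= !in_itv/=.
    move=> /andP[as_ sb]; have sb' : 0 < b - s by rewrite subr_gt0.
    exists (Num.truncn ((b - a) / (b - s))) => //=.
    rewrite in_itv/= as_/= lerBrDr -lerBrDl ler_pdivrMr// mulrC -ler_pdivrMr//.
    by rewrite ltW// truncnS_gt.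
  move=> /andP[-> sb]/=; apply: le_lt_trans sb _.
  by rewrite gtrBl divr_gt0.
have Fab n : [/\ a <= b - (b - a) / n.+1%:R & b - (b - a) / n.+1%:R < b].
  split; last by rewrite gtrBl divr_gt0.
  by rewrite lerBrDr -lerBrDl ler_pdivrMr// ler_peMr ?ler1n// ltW.
apply: (cvge_le _ (@ge0_nondecreasing_set_cvg_integral _ (measurableTypeR R) R F
  (fun s => ((b - s) `^ (c - 1))%:E) lebesgue_measure _ _ _ _)).
- apply: nearW => n; have [aF Fb] := Fab n.
  rewrite -ge0_integral_leb; last 3 first.
  + exact: measurable_itv.
  + exact: measurable_funTS.
  + by move=> s _; exact: powR_ge0.
  rewrite integral_powR_lt// lee_fin ler_pM2r ?invr_gt0//.
  by rewrite gerBl powR_ge0.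
- apply/nondecreasing_seqP => n; rewrite subsetEset /F => s/=; rewrite !in_itv/=.
  move=> /andP[-> /le_trans]; apply; rewrite lerD2l lerN2 ler_pM2l//.
  by rewrite lef_pV2 ?posrE// ler_nat.
- by move=> n; exact: measurable_itv.
- by move=> n; exact: m1e.
- by move=> n s _; rewrite lee_fin powR_ge0.
Qed.

(** * Hoelder, Young and Gronwall inequalities *)

Lemma integral_mul_le_hoelder d (X : measurableType d) (R : realType)
    (mu : {measure set X -> \bar R}) (D : set X) (f g : X -> R) (p q : R) :
  measurable D -> measurable_fun D f -> measurable_fun D g ->
  (forall x, D x -> 0 <= f x) -> (forall x, D x -> 0 <= g x) ->
  0 < p -> 0 < q -> p^-1 + q^-1 = 1 ->
  (\int[mu]_(x in D) (f x * g x)%:E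
   <= (\int[mu]_(x in D) (f x `^ p)%:E) `^ p^-1
      * (\int[mu]_(x in D) (g x `^ q)%:E) `^ q^-1)%E.
Proof.
move=> mD mf mg f0 g0 p0 q0 pq.
have E h r : (forall x, D x -> 0 <= h x) -> r != 0 ->
    (\int[mu]_(x in D) (h x `^ r)%:E
     = \int[mu]_x `|(EFin \o (h \_ D)%R) x| `^ r)%E.
  move=> h0 r0; rewrite integral_mkcond; apply: eq_integral => x _.
  rewrite /= !patchE; case: ifPn => [/set_mem Dx|_].
    by rewrite /= ger0_norm ?h0.
  by rewrite /= normr0 powR0.
rewrite !E ?gt_eqF//.
have := hoelder mu (f := f \_ D) (g := g \_ D) _ _ p0 q0 pq.
rewrite Lnorm1 !unlock => H; apply: le_trans (H _ _); [|exact/(measurable_restrictT _ mD)..].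
rewrite integral_mkcond le_eqVlt; apply/orP; left; apply/eqP.
apply: eq_integral => x _; rewrite /= !patchE; case: ifPn => [/set_mem Dx|_].
  by rewrite ger0_norm// mulr_ge0 ?f0 ?g0.
by rewrite mulr0 normr0.
Qed.

Lemma mul_le_young (R : realType) (a b p q : R) : 0 <= a -> 0 <= b ->
  0 < p -> 0 < q -> p^-1 + q^-1 = 1 -> a * b <= a `^ p + b `^ q.
Proof.
move=> a0 b0 p0 q0 pq; apply: le_trans (conjugate_powR a0 b0 p0 q0 pq) _.
have ip : 0 < p^-1 by rewrite invr_gt0.
have iq : 0 < q^-1 by rewrite invr_gt0.
by apply: lerD; rewrite ler_piMr ?powR_ge0//; lra.
Qed.

(** Let W be the primitive of v, finite because v is bounded by M, and weight it by exp(-2 B r).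
    Integrating the hypothesis turns a bound c on the weighted W into the bound al + c / 2, with al
    the integral of A. The finite supremum S of the weighted W therefore satisfies S <= al + S / 2,
    that is S <= 2 al. *)
Lemma gronwall (R : realType) (T B M : R) (v : R -> R) (A : R -> \bar R) :
  0 <= T -> 0 < B ->
  measurable_fun (`[0, T] : set (@lebR R)) (v : @lebR R -> R) ->
  measurable_fun (`[0, T] : set (@lebR R)) (A : @lebR R -> \bar R) ->
  (forall t, 0 <= t <= T -> 0 <= v t <= M) ->
  (forall t, 0 <= t <= T -> (0 <= A t)%E) ->
  {ae leb, forall t : R, 0 <= t <= T ->
     ((v t)%:E <= A t + B%:E * \int[leb]_(s in `[0%R, t]) (v s)%:E)%E} ->
  forall t, 0 <= t <= T ->
    (\int[leb]_(s in `[0%R, t]) (v s)%:E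
     <= (2 * expR (2 * B * T))%:E * \int[leb]_(s in `[0%R, T]) A s)%E.
Proof.
move=> T0 B0 mv mA v0 A0 vA t /andP[t0 tT].
set al := (\int[leb]_(s in `[0%R, T]) A s)%E.
have al0 : (0 <= al)%E by apply: integral_ge0 => s/=; rewrite in_itv; exact: A0.
have [->|alfin] := eqVneq al +oo%E.
  by rewrite gt0_muley ?leey// lte_fin mulr_gt0 ?expR_gt0.
have {alfin} alE : al = (fine al)%:E.
  by rewrite fineK// ge0_fin_numE// ltey.
have sub r : r <= T -> `[0, r] `<=` (`[0, T] : set (@lebR R)).
  by move=> rT s /=; rewrite !in_itv/= => /andP[-> /le_trans]; apply.
have mvr r : r <= T -> measurable_fun (`[0, r] : set (@lebR R)) (v : @lebR R -> R).
  by move=> rT; apply: measurable_funS mv => //; exact: sub.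
pose W r := (\int[leb]_(s in `[0%R, r]) (v s)%:E)%E.
have W0 r : r <= T -> (0 <= W r)%E.
  move=> rT; apply: integral_ge0 => s /(sub _ rT)/=.
  by rewrite in_itv/= lee_fin => /v0/andP[].
have M0 : 0 <= M.
  have /v0/andP[+ +] : 0 <= (0 : R) <= T by rewrite lexx.
  exact: le_trans.
have WM r : 0 <= r <= T -> (W r <= (M * T)%:E)%E.
  move=> /andP[r0 rT]; apply: (@le_trans _ _ (\int[leb]_(s in `[0%R, r]) (cst M%:E) s)%E).
    apply: ge0_le_integral => //.
    + by move=> s /(sub _ rT)/=; rewrite in_itv/= lee_fin => /v0/andP[].
    + by apply/measurable_EFinP; exact: mvr.
    + by move=> s /(sub _ rT)/=; rewrite in_itv/= lee_fin => /v0/andP[].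
  rewrite integral_cst//.
  rewrite [X in (_ * X)%E](leb_itvcc r0) subr0.
  by rewrite -EFinM lee_fin ler_wpM2l.
have Wfin r : 0 <= r <= T -> W r = (fine (W r))%:E.
  move=> rT; rewrite fineK// ge0_fin_numE; first exact: le_lt_trans (WM _ rT) (ltry _).
  by apply: W0; case/andP: rT.
have l0 : 0 < 2 * B by rewrite mulr_gt0.
(* One pass through the hypothesis: B c times the integral of exp(2 B s) over [0, r] is c / 2 times
   exp(2 B r) - 1, which is where the factor 1/2 arises. *)
have step c : 0 <= c -> (forall r, 0 <= r <= T -> fine (W r) <= c * expR (2 * B * r)) ->
    forall r, 0 <= r <= T -> fine (W r) <= (fine al + c / 2) * expR (2 * B * r).
  move=> c0 Wc r /[dup] rT' /andP[r0 rT].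
  have : (W r <= (fine al + B * c * ((expR (2 * B * r) - 1) / (2 * B)))%:E)%E.
    have mA' : measurable_fun (`[0, r] : set (@lebR R)) (A : @lebR R -> \bar R).
      by apply: measurable_funS mA => //; exact: sub.
    have mE : measurable_fun (`[0, r] : set (@lebR R))
        (fun s : @lebR R => (expR (2 * B * s))%:E).
      apply/measurable_EFinP; apply: Borel_lebR_fun; first exact: measurable_itv.
      apply: measurable_funTS; apply: measurableT_comp => //.
    have mE' : measurable_fun (`[0, r] : set (@lebR R))
        (fun s : @lebR R => (B * c)%:E * (expR (2 * B * s))%:E)%E.
      exact: measurable_funeM.
    apply: (@le_trans _ _ (\int[leb]_(s in `[0%R, r])
        (A s + (B * c)%:E * (expR (2 * B * s))%:E))%E).
      apply: ae_ge0_le_integral => //.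
      + by move=> s /(sub _ rT)/=; rewrite in_itv/= lee_fin => /v0/andP[].
      + by apply/measurable_EFinP; exact: mvr.
      + move=> s /(sub _ rT)/=; rewrite in_itv/= => /A0 As.
        by rewrite adde_ge0// -EFinM lee_fin mulr_ge0 ?expR_ge0// mulr_ge0// ltW.
      + exact: emeasurable_funD.
      + apply: (@filterS _ _ (@ae_filter_ringOfSetsType _ (@lebR R) R leb) _ _ _ vA) => s vs /(sub _ rT)/=; rewrite in_itv/= => sT.
        apply: le_trans (vs sT) _; rewrite leeD2l// -/(W s) Wfin// -!EFinM lee_fin.
        by rewrite -[B * c * _]mulrA ler_pM2l// Wc.
    rewrite ge0_integralD//; last 2 first.
    - by move=> s /(sub _ rT)/=; rewrite in_itv/= => /A0.
    - by move=> s _; rewrite -EFinM lee_fin mulr_ge0 ?expR_ge0// mulr_ge0// ltW.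
    rewrite ge0_integralZl; last 4 first.
    - by [].
    - exact: mE.
    - by move=> s _; rewrite lee_fin expR_ge0.
    - by rewrite lee_fin mulr_ge0// ltW.
    rewrite integral_expR// EFinD EFinM leeD2r// -alE.
    apply: ge0_subset_integral => //; exact: sub.
  rewrite Wfin// lee_fin => /le_trans; apply.
  have e1 : 1 <= expR (2 * B * r) by rewrite -[leLHS]expR0 ler_expR mulr_ge0// ltW.
  have -> : B * c * ((expR (2 * B * r) - 1) / (2 * B)) = c / 2 * (expR (2 * B * r) - 1).
    by field; rewrite gt_eqF.
  have : 0 <= fine al by rewrite fine_ge0.
  by nra.
pose S := [set fine (W r) / expR (2 * B * r) | r in `[0, T]].
have S0 : S !=set0 by exists (fine (W 0) / expR (2 * B * 0)); exists 0 => //=; rewrite in_itv/= lexx.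
have hS : has_sup S.
  split => //; exists (M * T) => _ [r /= + <-]; rewrite in_itv/= => rT.
  have e1 : 1 <= expR (2 * B * r).
    by case/andP: rT => r0 _; rewrite -[leLHS]expR0 ler_expR mulr_ge0// ltW.
  rewrite ler_pdivrMr ?expR_gt0//; have := WM r rT; rewrite Wfin// lee_fin => WMr.
  by apply: le_trans WMr _; rewrite ler_peMr// mulr_ge0.
have supP r : 0 <= r <= T -> fine (W r) <= sup S * expR (2 * B * r).
  move=> rT; rewrite -ler_pdivrMr ?expR_gt0//; apply: sup_upper_bound => //.
  by exists r => //=; rewrite in_itv.
have sup0 : 0 <= sup S.
  have : fine (W 0) <= sup S * expR (2 * B * 0) by apply: supP; rewrite lexx.
  rewrite mulr0 expR0 mulr1; apply: le_trans; apply: fine_ge0; exact: W0.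
have : sup S <= fine al + sup S / 2.
  apply: ge_sup => // _ [r /= + <-]; rewrite in_itv/= => rT.
  by rewrite ler_pdivrMr ?expR_gt0//; exact: step.
move=> supal; have {supal} supal : sup S <= 2 * fine al by lra.
rewrite -/(W t) Wfin ?t0// alE -EFinM lee_fin.
apply: le_trans (supP t _) _; first by rewrite t0.
have eT : expR (2 * B * t) <= expR (2 * B * T) by rewrite ler_expR ler_pM2l.
rewrite [leRHS]mulrAC; apply: ler_pM => //; exact: expR_ge0.
Qed.

(** * Euclidean norm and measurability of superpositions *)

Lemma measurable_fun_pair_in d d1 d2 (Z : measurableType d)
    (T1 : measurableType d1) (T2 : measurableType d2) (E : set Z)
    (f : Z -> T1) (g : Z -> T2) :
  measurable_fun E f -> measurable_fun E g ->
  measurable_fun E (fun z => (f z, g z)).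
Proof.
move=> mf mg mE.
pose C := [set B : set (T1 * T2) | measurable (E `&` (fun z => (f z, g z)) @^-1` B)].
have CS : sigma_algebra setT C.
  split; rewrite /C/=.
  - by rewrite preimage_set0 setI0.
  - move=> B mB; rewrite setTD preimage_setC -setDE.
    rewrite (_ : _ `\` _ = E `\` (E `&` (fun z => (f z, g z)) @^-1` B)).
      exact: measurableD.
    by rewrite setDIr setDv set0U.
  - move=> F mF; rewrite preimage_bigcup setI_bigcupr.
    exact: bigcup_measurable.
move=> B mB; suff : C B by [].
apply: (smallest_sub CS _ mB).
by move=> _ [] [S mS <-]; rewrite /C/= setTI; [exact: mf|exact: mg].
Qed.

Section Enorm.
Context {R : realType} {n : nat}.
Implicit Types x y : 'rV[R]_n.

Lemma enorm_ge0 x : 0 <= enorm x.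
Proof. exact: sqrtr_ge0. Qed.

Lemma normr_coord_le_enorm x i : `|x ord0 i| <= enorm x.
Proof.
rewrite -sqrtr_sqr ler_wsqrtr// (bigD1 i)//= lerDl.
by apply: sumr_ge0 => j _; exact: sqr_ge0.
Qed.

Lemma enorm_le_sum x : enorm x <= \sum_i `|x ord0 i|.
Proof.
rewrite /enorm.
have s0 : 0 <= \sum_i `|x ord0 i| by apply: sumr_ge0.
rewrite -[leRHS](ger0_norm s0) -sqrtr_sqr ler_wsqrtr//.
have [//] : \sum_i x ord0 i ^+ 2 <= (\sum_i `|x ord0 i|) ^+ 2 /\ 0 <= \sum_i `|x ord0 i|.
apply: (big_rec2 (fun a b => a <= b ^+ 2 /\ 0 <= b)); first by rewrite expr0n.
move=> i a b _ [ab b0]; split; last by rewrite addr_ge0.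
rewrite sqrrD real_normK ?num_real// -addrA lerD2l.
by apply: le_trans ab _; rewrite lerDr mulrn_wge0// mulr_ge0.
Qed.

Lemma enorm_le_coord x (M : R) : (forall i, `|x ord0 i| <= M) -> enorm x <= M *+ n.
Proof.
move=> xM; apply: le_trans (enorm_le_sum x) _.
by apply: le_trans (ler_sum _ (fun i _ => xM i)) _; rewrite sumr_const card_ord.
Qed.

Lemma enorm0 : enorm (0 : 'rV[R]_n) = 0.
Proof. by rewrite /enorm big1 ?sqrtr0// => i _; rewrite mxE expr0n. Qed.

Lemma enormB x y : enorm (x - y) = enorm (y - x).
Proof. by rewrite /enorm; congr Num.sqrt; apply: eq_bigr => i _; rewrite -sqrrN !mxE opprB. Qed.

Lemma enorm_eq0 x : enorm x = 0 -> x = 0.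
Proof.
move=> x0; apply/rowP => i; rewrite mxE; apply/eqP; rewrite -normr_le0 -x0.
exact: normr_coord_le_enorm.
Qed.

Lemma measurable_enorm d (Z : measurableType d) (E : set Z) (X : Z -> 'rV[R]_n) :
  (forall i, measurable_fun E (fun z => X z ord0 i)) ->
  measurable_fun E (fun z => enorm (X z)).
Proof.
move=> mX.
rewrite (_ : (fun z => _) = fun z => (\sum_(i < n) X z ord0 i ^+ 2) `^ 2^-1).
  apply: (measurableT_comp (measurable_powR _)).
  by apply: measurable_sum => i; exact: measurable_funX.
by apply/funext => z; rewrite powR12_sqrt// sumr_ge0// => i _; rewrite sqr_ge0.
Qed.

Lemma measurable_coord i : measurable_fun [set: borel_rV n] (fun v : borel_rV n => v ord0 i : R).
Proof.
move=> _; apply: (measurability _ (RGenOpens.measurableE R)) => //.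
move=> _ [_ [a [b ->] <-]]; rewrite setTI; apply: sub_sigma_algebra.
have /continuousP := @coord_continuous R 1 n ord0 i.
by apply; exact: interval_open.
Qed.
End Enorm.

(** The domain of f need not be measurable. On that domain a preimage under f is the trace of a
    measurable set A, and all of E is sent into the domain, so the preimage in E is exactly the
    preimage of A under a measurable map. *)
Lemma measurable_field_comp (R : realType) (n m : nat) (T : R)
    (U : set 'rV[R]_m) (f : R -> R -> 'rV[R]_n -> 'rV[R]_m -> 'rV[R]_n)
    d (Z : measurableType d) (E : set Z) (tau sigma : Z -> @lebR R)
    (X : Z -> borel_rV n) (V : Z -> borel_rV m) i :
  measurable_field T U f ->
  measurable_fun E tau -> measurable_fun E sigma ->
  measurable_fun E X -> measurable_fun E V ->
  (forall z, E z -> Delta T (tau z, sigma z) /\ U (V z)) ->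
  measurable_fun E (fun z => f (tau z) (sigma z) (X z) (V z) ord0 i : R).
Proof.
move=> mf mt ms mX mV EU mE B mB.
have [A mA DA] := mf _ (measurable_coord i measurableT mB).
rewrite setTI in DA.
have := measurable_fun_pair_in (measurable_fun_pair_in mt ms)
  (measurable_fun_pair_in mX mV) mE mA.
congr measurable; apply/seteqP; split => z [Ez zA]; split => //.
  have : (([set z | Delta T z.1 /\ U z.2.2] `&` A) 
      ((tau z, sigma z), (X z, V z))) by split => //; exact: EU.
  by rewrite -DA => -[].
have : (([set z : (@lebR R * @lebR R) * (borel_rV n * borel_rV m) | Delta T z.1 /\ U z.2.2] `&`
   (fun z => f z.1.1 z.1.2 z.2.1 z.2.2) @^-1` ((fun v => v ord0 i) @^-1` B)) 
      ((tau z, sigma z), (X z, V z))) by split => //=; exact: EU.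
by rewrite DA => -[].
Qed.

(** * Continuous paths on [0, T] *)

Section Path.
Context {R : realType} {n : nat} {T : R}.
Implicit Types x : R -> 'rV[R]_n.

Lemma continuous_coord x i : {within `[0, T], continuous x} ->
  {within `[0, T], continuous (fun t => x t ord0 i)}.
Proof.
move=> /subspace_continuousP cx; apply/subspace_continuousP => t tT.
exact: cvg_comp (cx t tT) (@coord_continuous R 1 n ord0 i (x t)).
Qed.

Lemma measurable_continuous_path x : {within `[0, T], continuous x} ->
  measurable_fun (`[0, T] : set (@lebR R)) (x : @lebR R -> borel_rV n).
Proof.
move=> /continuousP cx; apply: (@measurability _ _ (@lebR R) (borel_rV n) _ _ (@open 'rV[R]_n)) => //.
move=> _ [W oW <-]; apply: Borel_lebR.
exact: (open_measurable_subspace (measurable_itv _) (cx _ oW)).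
Qed.

Lemma continuous_enorm_bounded x : 0 <= T -> {within `[0, T], continuous x} ->
  exists2 M, 0 <= M & forall t, 0 <= t <= T -> enorm (x t) <= M.
Proof.
move=> T0 cx.
have H i : exists M, forall t, 0 <= t <= T -> `|x t ord0 i| <= M.
  have cxi : {within `[0, T], continuous (fun t => `|x t ord0 i|)}.
    move=> t; apply: (@continuous_comp (subspace `[0, T])); first exact: continuous_coord.
    exact: norm_continuous.
  have [c _ cM] := EVT_max T0 cxi; exists `|x c ord0 i| => t tT.
  by apply: cM; rewrite in_itv.
have {H} [M MP] := choice H.
exists (\sum_i `|M i|); first by apply: sumr_ge0.
move=> t tT; apply: le_trans (enorm_le_sum _) _; apply: ler_sum => i _.
by apply: le_trans (MP i t tT) _; exact: ler_norm.
Qed.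

Lemma continuous_pathP x :
  {within `[0, T], continuous x} <->
  (forall t, 0 <= t <= T -> forall e, 0 < e -> exists2 del, 0 < del &
    forall s, 0 <= s <= T -> `|t - s| < del -> enorm (x t - x s) <= e).
Proof.
split=> [/subspace_continuousP cx t tT e e0|cx].
  (* The successor keeps the quotient meaningful when n = 0; n coordinates of size e / (n + 1) sum
     to at most e. *)
  have e' : 0 < e / n.+1%:R by rewrite divr_gt0.
  have /cvg_ballP/(_ _ e') := cx t tT.
  rewrite near_withinE => /nbhs_ballP[del /= del0 H].
  exists del => // s sT ts; apply: le_trans (enorm_le_coord (M := e / n.+1%:R) _) _.
    move=> i; rewrite !mxE; apply: ltW.
    by have [|_] := H s ts; [rewrite /= in_itv|exact].
  rewrite -[leLHS]mulr_natr -mulrA ler_piMr ?(ltW e0)// mulrC ler_pdivrMr// mul1r ler_nat.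
  exact: leqnSn.
apply/subspace_continuousP => t; rewrite /= in_itv/= => tT.
apply/cvg_ballP => e e0.
have [|del del0 xdel] := cx t tT (e / 2); first by rewrite divr_gt0.
near=> s; split => // a i; rewrite (ord1 a) /ball/=.
have := normr_coord_le_enorm (x t - x s) i; rewrite !mxE => /le_lt_trans; apply.
apply: le_lt_trans (_ : e / 2 < e); last by rewrite ltr_pdivrMr// ltr_pMr// ltr1n.
apply: xdel.
  by near: s; exact: withinT.
by near: s; apply: cvg_within; apply/nbhs_ballP; exists del.
Unshelve. all: by end_near. Qed.
End Path.

(** As T > 0, every neighbourhood of t meets [0, T] in a set of positive measure, which cannot lie
    inside a negligible set. *)
Lemma ae_dense (R : realType) (T : R) (P : R -> Prop) : 0 < T ->
  {ae leb, forall t : R, 0 <= t <= T -> P t} ->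
  forall t del, 0 <= t <= T -> 0 < del ->
    exists s, [/\ 0 <= s <= T, `|t - s| < del & P s].
Proof.
move=> T0 aeP t del /andP[t0 tT] del0; apply: contrapT => noP.
(* A nondegenerate interval inside [0, T] and inside the ball of radius [del] around t. *)
pose a := Num.max 0 (t - del / 2); pose b := Num.min T (t + del / 2).
have d2 : 0 < del / 2 by rewrite divr_gt0.
have d2d : del / 2 < del by lra.
have ab : a < b by rewrite /a /b lt_min !gt_max; apply/andP; split; apply/andP; split; lra.
have abT s : a <= s <= b -> 0 <= s <= T /\ `|t - s| < del.
  rewrite /a /b le_min ge_max => /andP[/andP[s0 ts] /andP[sT st]].
  by rewrite s0 sT; split => //; rewrite ltr_norml; apply/andP; split; lra.
have : leb.-negligible (`[a, b] : set (@lebR R)).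
  apply: negligibleS aeP => s/=; rewrite in_itv/= => /abT[sT ts] Ps.
  by apply: noP; exists s; split => //; exact: Ps.
move=> /(measure_negligible (measurable_itv_lebR _)) ab0.
have : (b - a)%:E = 0%E by rewrite -(leb_itvcc (ltW ab)); exact: ab0.
by move=> -[]/eqP; rewrite subr_eq0 gt_eqF.
Qed.

(** * Integrability of the kernel (t - s)^(theta - 1) *)

Lemma powR_subadd (R : realType) (a b q : R) : 0 <= b <= a -> 1 <= q ->
  (a - b) `^ q + b `^ q <= a `^ q.
Proof.
move=> /andP[b0 ba] q1; have [a0|a0] := eqVneq a 0.
  have -> : b = 0 by apply/eqP; rewrite eq_le b0 -a0 ba.
  by rewrite a0 subrr powR0 ?addr0//; lra.
have {}a0 : 0 < a by rewrite lt_neqAle eq_sym a0 (le_trans b0).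
(* Since q >= 1 and x / a <= 1, (x / a)^q <= x / a; adding the cases x = a - b and x = b gives
   superadditivity of the power. *)
have H x : 0 <= x <= a -> x `^ q <= x / a * a `^ q.
  move=> /andP[]; rewrite le_eqVlt => /predU1P[<-|x0] xa.
    by rewrite powR0 ?mul0r//; lra.
  rewrite -{1}[x](divfK (lt0r_neq0 a0)); apply: ge1r_powRZ => //; last exact: ltW.
  by rewrite divr_gt0//= ler_pdivrMr// mul1r.
have h1 := H b; have h2 := H (a - b).
apply: le_trans (lerD (h2 _) (h1 _)) _; rewrite ?b0//.
  by rewrite subr_ge0 ba gerBl.
by rewrite -!mulrDl subrK divff ?mul1r// gt_eqF.
Qed.

Section Kernel.
Context {R : realType}.
Implicit Types (theta q r s t a b : R).

Lemma measurable_kernel theta t (D : set R) : measurable D ->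
  measurable_fun (D : set (@lebR R)) (fun s : @lebR R => (t - s) `^ (theta - 1)).
Proof.
move=> mD; apply: Borel_lebR_fun => //; apply: measurable_funTS.
by apply: (measurableT_comp (measurable_powR _)); exact: measurable_funB.
Qed.

Lemma integral_kernel_le theta q a b t : a <= b -> b <= t ->
  0 < 1 - (1 - theta) * q ->
  (\int[leb]_(s in `[a, b]) (((t - s) `^ (theta - 1)) `^ q)%:E
   <= (((t - a) `^ (1 - (1 - theta) * q) - (t - b) `^ (1 - (1 - theta) * q))
        / (1 - (1 - theta) * q))%:E)%E.
Proof.
move=> ab bt c0; under eq_integral do rewrite -powRrM.
rewrite (_ : (theta - 1) * q = (1 - (1 - theta) * q) - 1); last by ring.
exact: integral_powR_le.
Qed.

Lemma integral_kernel_lt theta q a b t : a <= b -> b < t ->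
  0 < 1 - (1 - theta) * q ->
  (\int[leb]_(s in `[a, b]) (((t - s) `^ (theta - 1)) `^ q)%:E
   = (((t - a) `^ (1 - (1 - theta) * q) - (t - b) `^ (1 - (1 - theta) * q))
        / (1 - (1 - theta) * q))%:E)%E.
Proof.
move=> ab bt c0; under eq_integral do rewrite -powRrM.
rewrite (_ : (theta - 1) * q = (1 - (1 - theta) * q) - 1); last by ring.
exact: integral_powR_lt.
Qed.

(** The exponents q / P and r / P are conjugate, so Young's inequality bounds the P-th power of the
    product by the q-th power of the kernel plus K^r; the condition (1 - theta) q < 1 makes the
    first integrable, uniformly in t. *)
Lemma kernel_mul_bound theta q r P T (K : R -> R) : 0 <= T ->
  0 < 1 - (1 - theta) * q -> 0 < q -> 0 < r -> 0 < P -> P^-1 = q^-1 + r^-1 ->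
  measurable_fun (`[0, T] : set (@lebR R)) (K : @lebR R -> R) ->
  (forall s, 0 <= s <= T -> 0 <= K s) ->
  (\int[leb]_(s in `[0%R, T]) (K s `^ r)%:E < +oo)%E ->
  exists2 M, 0 <= M & forall t, 0 <= t <= T ->
    (\int[leb]_(s in `[0%R, t]) (((t - s) `^ (theta - 1) * K s) `^ P)%:E
     <= M%:E)%E.
Proof.
move=> T0 c0 q0 r0 P0 Pqr mK K0 Kr.
set c := 1 - (1 - theta) * q in c0.
have Kr0 : (0 <= \int[leb]_(s in `[0%R, T]) (K s `^ r)%:E)%E.
  by apply: integral_ge0 => s _; rewrite lee_fin powR_ge0.
pose Nr := fine (\int[leb]_(s in `[0%R, T]) (K s `^ r)%:E)%E.
have NrE : (\int[leb]_(s in `[0%R, T]) (K s `^ r)%:E = Nr%:E)%E.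
  by rewrite fineK// ge0_fin_numE.
exists (T `^ c / c + Nr).
  by rewrite addr_ge0 ?fine_ge0// divr_ge0 ?powR_ge0// ltW.
move=> t /andP[t0 tT].
have sub : `[0, t] `<=` (`[0, T] : set (@lebR R)).
  by move=> s /=; rewrite !in_itv/= => /andP[-> /le_trans]; apply.
have mKr : measurable_fun (`[0, T] : set (@lebR R)) (fun s : @lebR R => (K s `^ r)%:E).
  by apply/measurable_EFinP; apply: (measurableT_comp (measurable_powR _)).
have mK' : measurable_fun (`[0, t] : set (@lebR R)) (K : @lebR R -> R).
  by apply: measurable_funS mK.
have mk := @measurable_kernel theta t `[0, t] (measurable_itv _).
have mkq : measurable_fun (`[0, t] : set (@lebR R))
    (fun s : @lebR R => (((t - s) `^ (theta - 1)) `^ q)%:E).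
  by apply/measurable_EFinP; apply: (measurableT_comp (measurable_powR _)).
have mKr' : measurable_fun (`[0, t] : set (@lebR R)) (fun s : @lebR R => (K s `^ r)%:E).
  by apply: measurable_funS mKr.
apply: (@le_trans _ _ (\int[leb]_(s in `[0%R, t])
   ((((t - s) `^ (theta - 1)) `^ q)%:E + (K s `^ r)%:E))%E).
  apply: ge0_le_integral.
  - exact: measurable_itv_lebR.
  - by move=> s _; rewrite lee_fin powR_ge0.
  - apply/measurable_EFinP; apply: (measurableT_comp (measurable_powR _)).
    exact: measurable_funM.
  - exact: emeasurable_funD.
  - move=> s /sub/=; rewrite in_itv/= => /K0 Ks.
    rewrite -EFinD lee_fin powRM ?powR_ge0//.
    have -> : q = P * (q / P) by rewrite mulrC divfK// gt_eqF.
    have -> : r = P * (r / P) by rewrite mulrC divfK// gt_eqF.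
    rewrite !(powRrM _ P); apply: mul_le_young; rewrite ?powR_ge0 ?divr_gt0//.
    by rewrite !invf_div -mulrDr -Pqr divff// gt_eqF.
rewrite ge0_integralD//; try by move=> s _; rewrite lee_fin powR_ge0.
rewrite EFinD leeD//.
  apply: le_trans (integral_kernel_le t0 (lexx _) c0) _.
  rewrite lee_fin subrr subr0 ler_pM2r ?invr_gt0// (@powR0 _ c) ?gt_eqF// subr0.
  by rewrite ge0_ler_powR ?nnegrE ?(ltW c0).
rewrite -NrE; apply: ge0_subset_integral => //.
by move=> s _; rewrite lee_fin powR_ge0.
Qed.

(** Hoelder with three factors: the kernel in L^q, K in L^r and w in L^p. The first two are merged
    into a single factor in L^P, P being conjugate to p. Raising to the power p leaves the integral
    of w^p without an outer exponent, the form that Gronwall requires. *)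
Lemma kernel_hoelder theta q r p T (K : R -> R) : 0 <= T -> 1 < p ->
  0 < 1 - (1 - theta) * q -> 0 < q -> 0 < r -> p^-1 + (q^-1 + r^-1) = 1 ->
  measurable_fun (`[0, T] : set (@lebR R)) (K : @lebR R -> R) ->
  (forall s, 0 <= s <= T -> 0 <= K s) ->
  (\int[leb]_(s in `[0%R, T]) (K s `^ r)%:E < +oo)%E ->
  exists2 B, 0 < B & forall t (w : R -> R), 0 <= t <= T ->
    measurable_fun (`[0, t] : set (@lebR R)) (w : @lebR R -> R) ->
    (forall s, 0 <= s <= t -> 0 <= w s) ->
    ((\int[leb]_(s in `[0%R, t]) ((t - s) `^ (theta - 1) * K s * w s)%:E) `^ p
     <= B%:E * \int[leb]_(s in `[0%R, t]) (w s `^ p)%:E)%E.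
Proof.
move=> T0 p1 c0 q0 r0 pqr mK K0 Kr.
have p0 : 0 < p by apply: lt_trans p1.
have P0 : 0 < (q^-1 + r^-1)^-1 by rewrite invr_gt0 addr_gt0 ?invr_gt0.
have [|M M0 MP] := kernel_mul_bound T0 c0 q0 r0 P0 _ mK K0 Kr; first by rewrite invrK.
set P := (q^-1 + r^-1)^-1 in P0 MP *.
(* The added 1 makes the constant strictly positive; [gronwall] divides by 2 B. *)
exists (M `^ (P^-1 * p) + 1).
  by rewrite ltr_wpDl ?powR_ge0.
move=> t w /andP[t0 tT] mw w0.
have sub : `[0, t] `<=` (`[0, T] : set (@lebR R)).
  by move=> s /=; rewrite !in_itv/= => /andP[-> /le_trans]; apply.
have wp0 : (0 <= \int[leb]_(s in `[0%R, t]) (w s `^ p)%:E)%E.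
  by apply: integral_ge0 => s _; rewrite lee_fin powR_ge0.
have kK0 s : `[0, t]%classic s -> 0 <= (t - s) `^ (theta - 1) * K s.
  by move=> /sub/=; rewrite in_itv/= => /K0 Ks; rewrite mulr_ge0 ?powR_ge0.
have := @integral_mul_le_hoelder _ (@lebR R) R leb `[0, t]
  (fun s => (t - s) `^ (theta - 1) * K s) w P p.
move=> /(_ _ _ mw kK0 _ P0 p0)H.
have {H} := H (measurable_itv_lebR _).
move=> /(_ _ _ _)H.
apply: le_trans.
  apply: (gt0_ler_poweR (ltW p0) _ _ (H _ _ _)).
  - rewrite in_itv/= leey andbT; apply: integral_ge0 => s ts.
    by rewrite lee_fin mulr_ge0 ?kK0 ?w0.
  - by rewrite in_itv/= leey andbT mule_ge0 ?poweR_ge0.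
  - apply: measurable_funM; first exact: measurable_kernel (measurable_itv _).
    exact: measurable_funS mK.
  - by move=> s; rewrite /= in_itv; exact: w0.
  - by rewrite invrK addrC.
rewrite poweRM ?poweR_ge0// -!poweRrM (mulVf (lt0r_neq0 p0)) poweRe1//.
rewrite lee_wpmul2r//.
apply: (@le_trans _ _ (M%:E `^ (P^-1 * p))%E); last first.
  by rewrite poweR_EFin lee_fin lerDl.
have Pp0 : 0 < P^-1 * p by apply: mulr_gt0 p0; rewrite (invr_gt0 P).
apply: gt0_ler_poweR; first exact: ltW.
- rewrite in_itv/= leey andbT.
  by apply: integral_ge0 => s _; rewrite lee_fin powR_ge0.
- by rewrite in_itv/= leey andbT lee_fin.
by apply: MP; rewrite t0.
Qed.
End Kernel.

Lemma le_integral_integrable d (X : measurableType d) (R : realType)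
    (mu : {measure set X -> \bar R}) (D : set X) (f g : X -> R) (b : R) :
  measurable D -> measurable_fun D f -> measurable_fun D g ->
  (forall x, D x -> `|f x| <= g x) ->
  (\int[mu]_(x in D) (g x)%:E <= b%:E)%E ->
  mu.-integrable D (EFin \o f) /\ `|Rintegral mu D f| <= b.
Proof.
move=> mD mf mg fg gb.
have fb : (\int[mu]_(x in D) `|(f x)%:E| <= b%:E)%E.
  apply: le_trans gb; apply: ge0_le_integral => //.
  - by apply: measurableT_comp => //; exact/measurable_EFinP.
  - exact/measurable_EFinP.
have intf : mu.-integrable D (EFin \o f).
  apply/integrableP; split; first exact/measurable_EFinP.
  exact: le_lt_trans fb (ltry _).
split => //; apply: le_trans (le_normr_Rintegral mD intf) _.
rewrite -lee_fin /Rintegral fineK//.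
by rewrite ge0_fin_numE ?integral_ge0//; exact: le_lt_trans fb (ltry _).
Qed.

Lemma volterra_modulus (R : realType) (theta q r T : R) (G om : R -> R) :
  0 <= T -> 0 < theta <= 1 -> 0 < 1 - (1 - theta) * q -> 0 < q -> 0 < r ->
  q^-1 + r^-1 = 1 ->
  measurable_fun (`[0, T] : set (@lebR R)) (G : @lebR R -> R) ->
  (forall s, 0 <= s <= T -> 0 <= G s) ->
  (\int[leb]_(s in `[0%R, T]) (G s `^ r)%:E < +oo)%E ->
  (forall h, 0 <= h -> 0 <= om h) ->
  exists2 C, 0 <= C & forall F : R -> R -> R,
    (forall t, 0 <= t <= T ->
       measurable_fun (`[0, t] : set (@lebR R)) (F t : @lebR R -> R)) ->
    (forall t s, 0 <= s -> s <= t -> t <= T -> `|F t s| <= G s) ->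
    (forall t t' s, 0 <= s -> s <= t -> t < t' -> t' <= T ->
       `|F t' s - F t s| <= om (t' - t)) ->
    (forall t, 0 <= t <= T -> leb.-integrable `[0, t]
       (fun s : R => ((t - s) `^ (theta - 1) * F t s)%:E)) /\
    (forall t t', 0 <= t -> t < t' -> t' <= T ->
       `|Rintegral leb `[0, t'] (fun s => (t' - s) `^ (theta - 1) * F t' s)
         - Rintegral leb `[0, t] (fun s => (t - s) `^ (theta - 1) * F t s)|
       <= C * ((t' - t) `^ ((1 - (1 - theta) * q) / q) + om (t' - t))).
Proof.
move=> T0 /andP[th0 th1] c0 q0 r0 qr mG G0 Gr om0.
set c := 1 - (1 - theta) * q in c0 *.
have one : (1 : R)^-1 = q^-1 + r^-1 by rewrite invr1 qr.
have [M M0 MP] := kernel_mul_bound T0 c0 q0 r0 ltr01 one mG G0 Gr.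
have q1 : 1 <= q.
  rewrite -[leLHS]invr1 -[leRHS]invrK lef_pV2 ?posrE ?invr_gt0//.
  by rewrite -qr lerDl invr_ge0 ltW.
pose Nr := fine ((\int[leb]_(s in `[0%R, T]) (G s `^ r)%:E) `^ r^-1)%E.
have NrE : ((\int[leb]_(s in `[0%R, T]) (G s `^ r)%:E) `^ r^-1 = Nr%:E)%E.
  rewrite fineK// fin_num_poweR// ge0_fin_numE//.
  by apply: integral_ge0 => s _; rewrite lee_fin powR_ge0.
have Nr0 : 0 <= Nr by exact/fine_ge0/poweR_ge0.
(* The doubled term pays for the integral over ]t, t'] and for the change of kernel; T^theta / theta
   bounds the integral of the kernel. *)
exists (2 * ((c^-1 `^ q^-1) * Nr) + T `^ theta / theta).
  by rewrite addr_ge0 ?divr_ge0 ?powR_ge0 ?mulr_ge0 ?powR_ge0// ltW.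
move=> F mF FG Fom.
have sub t : t <= T -> `[0, t] `<=` (`[0, T] : set (@lebR R)).
  by move=> tT s /=; rewrite !in_itv/= => /andP[-> /le_trans]; apply.
have mk t a b : measurable_fun (`[a, b] : set (@lebR R))
    (fun s : @lebR R => (t - s) `^ (theta - 1)).
  exact: measurable_kernel (measurable_itv _).
have mGt a b : 0 <= a -> b <= T ->
    measurable_fun (`[a, b] : set (@lebR R)) (G : @lebR R -> R).
  move=> a0 bT; apply: measurable_funS mG => // s/=; rewrite !in_itv/=.
  by move=> /andP[as_ sb]; rewrite (le_trans a0)//= (le_trans sb).
(* Hoelder against G on a subinterval *)
have hoelderG a b (k : R -> R) (M' : R) : 0 <= a -> b <= T ->
    measurable_fun (`[a, b] : set (@lebR R)) (k : @lebR R -> R) ->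
    (forall s, a <= s <= b -> 0 <= k s) -> 0 <= M' ->
    (\int[leb]_(s in `[a, b]) (k s `^ q)%:E <= M'%:E)%E ->
    (\int[leb]_(s in `[a, b]) (k s * G s)%:E <= (M' `^ q^-1 * Nr)%:E)%E.
  move=> a0 bT mk' k0 M'0 kM'.
  have abT : `[a, b] `<=` (`[0, T] : set (@lebR R)).
    by move=> s/=; rewrite !in_itv/= => /andP[as_ sb]; rewrite (le_trans a0)//= (le_trans sb).
  have H := @integral_mul_le_hoelder _ (@lebR R) R leb `[a, b] k G q r
    (measurable_itv_lebR _) mk' (mGt _ _ a0 bT) _ _ q0 r0 qr.
  apply: le_trans (H _ _) _.
  - by move=> s; rewrite /= in_itv; exact: k0.
  - by move=> s /abT; rewrite /= in_itv; exact: G0.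
  rewrite EFinM -poweR_EFin -NrE.
  have mono (x y : \bar R) e : 0 < e -> (0 <= x)%E -> (x <= y)%E -> (x `^ e <= y `^ e)%E.
    move=> e0 x0 xy; apply: gt0_ler_poweR; rewrite ?in_itv/= ?leey ?andbT ?(ltW e0)//.
    exact: le_trans xy.
  have int0 D h e : (0 <= \int[leb]_(s in D) (h s `^ e)%:E)%E.
    by apply: integral_ge0 => s _; rewrite lee_fin powR_ge0.
  apply: lee_pmul; rewrite ?poweR_ge0//; apply: mono; rewrite ?invr_gt0//; try exact: int0.
  apply: ge0_subset_integral => //; last by move=> s _; rewrite lee_fin powR_ge0.
  by apply/measurable_EFinP; apply: (measurableT_comp (measurable_powR _)).
have intF t : 0 <= t <= T -> leb.-integrable `[0, t]
    (EFin \o (fun s : R => ((t - s) `^ (theta - 1) * F t s))).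
  move=> /[dup] tT' /andP[t0 tT].
  have [||||+ _] := @le_integral_integrable _ (@lebR R) R leb `[0, t]
    (fun s => (t - s) `^ (theta - 1) * F t s) (fun s => ((t - s) `^ (theta - 1) * G s) `^ 1) M
    (measurable_itv_lebR _) => //.
  - by apply: measurable_funM => //; exact: mF.
  - by apply: (measurableT_comp (measurable_powR _)); apply: measurable_funM => //; exact: mGt.
  - move=> s; rewrite /= in_itv/= => /andP[s0 st].
    have Gs : 0 <= G s by apply: G0; rewrite s0 (le_trans st).
    rewrite powRr1 ?mulr_ge0 ?powR_ge0// normrM ger0_norm ?powR_ge0//.
    by rewrite ler_wpM2l ?powR_ge0// FG.
  - exact: MP.
split; first exact: intF.
move=> t t' t0 tt' t'T.
have tT : t <= T := le_trans (ltW tt') t'T.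
have t'0 : 0 <= t' := le_trans t0 (ltW tt').
have h0 : 0 < t' - t by rewrite subr_gt0.
have omh : 0 <= om (t' - t) by apply: om0; exact: ltW.
pose k s := (t - s) `^ (theta - 1); pose k' s := (t' - s) `^ (theta - 1).
pose H := (t' - t) `^ c / c.
have H0 : 0 <= H by rewrite divr_ge0 ?powR_ge0// ltW.
have HE : H `^ q^-1 = (t' - t) `^ (c / q) * c^-1 `^ q^-1.
  by rewrite /H powRM ?powR_ge0 ?invr_ge0 ?(ltW c0)// -powRrM.
have mkk' : measurable_fun (`[0, t] : set (@lebR R)) (fun s : @lebR R => `|k s - k' s|).
  by apply: measurableT_comp => //; apply: measurable_funB; exact: mk.
(* Superadditivity gives |k - k'|^q + k'^q <= k^q for k' <= k. Integrating leaves (t^c - t'^c + (t'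
   - t)^c) / c, which is at most H because t <= t'. *)
have kk'q : (\int[leb]_(s in `[0%R, t]) (`|k s - k' s| `^ q)%:E <= H%:E)%E.
  have mq (g : R -> R) : measurable_fun (`[0, t] : set (@lebR R)) (g : @lebR R -> R) ->
      measurable_fun (`[0, t] : set (@lebR R)) (fun s : @lebR R => (g s `^ q)%:E).
    by move=> mg; apply/measurable_EFinP; apply: (measurableT_comp (measurable_powR _)).
  have : (\int[leb]_(s in `[0%R, t]) ((`|k s - k' s| `^ q)%:E + (k' s `^ q)%:E)
      <= \int[leb]_(s in `[0%R, t]) (k s `^ q)%:E)%E.
    apply: ae_ge0_le_integral.
    - exact: measurable_itv_lebR.
    - by move=> s _; rewrite -EFinD lee_fin addr_ge0 ?powR_ge0.
    - by apply: emeasurable_funD; apply: mq; [exact: mkk'|exact: mk].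
    - by move=> s _; rewrite lee_fin powR_ge0.
    - by apply: mq; exact: mk.
    (* At s = t with theta < 1 the convention that 0 to a nonzero power is 0 makes [k t] vanish and
       the pointwise inequality fail, so the null set {t} is excluded. *)
    - have neg : leb.-negligible ([set t] : set (@lebR R)).
        exists (`[t, t]%classic : set (@lebR R)); split => //.
        + by have := leb_itvcc (lexx t); rewrite subrr.
        + by move=> s /= ->; rewrite in_itv/= lexx.
      apply: negligibleS neg => s /= ns; apply: contrapT => st; apply: ns => /=.
      rewrite in_itv/= => /andP[s0]; rewrite le_eqVlt => /predU1P[//|{}st].
      have kk' : k' s <= k s.
        rewrite /k /k' -(opprB 1 theta) !powRN lef_pV2 ?posrE ?powR_gt0 ?subr_gt0//; last exact: lt_trans tt'.
        rewrite ge0_ler_powR ?nnegrE ?subr_ge0 ?(ltW st)//; last by rewrite lerD2r ltW.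
        exact: ltW (lt_trans st tt').
      rewrite -EFinD lee_fin ger0_norm ?subr_ge0//.
      by apply: powR_subadd => //; rewrite powR_ge0.
  rewrite ge0_integralD; first last.
  - by apply: mq; exact: mk.
  - by move=> s _; rewrite lee_fin powR_ge0.
  - by apply: mq; exact: mkk'.
  - by move=> s _; rewrite lee_fin powR_ge0.
  - exact: measurable_itv_lebR.
  rewrite (integral_kernel_lt t0 tt' c0) -/c => /le_trans.
  move=> /(_ _ (integral_kernel_le t0 (lexx t) c0)).
  rewrite -/c -leeBrDr// -EFinB => /le_trans; apply.
  rewrite lee_fin !subr0 subrr (@powR0 _ c) ?gt_eqF// subr0 -mulrBl.
  rewrite ler_pM2r ?invr_gt0// opprB addrCA gerDl subr_le0.
  by rewrite ge0_ler_powR ?nnegrE ?(ltW c0) ?(ltW tt').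
have kG : (\int[leb]_(s in `[0%R, t]) (`|k s - k' s| * G s)%:E
    <= (H `^ q^-1 * Nr)%:E)%E by apply: hoelderG.
have k'G : (\int[leb]_(s in `[t, t']) (k' s * G s)%:E <= (H `^ q^-1 * Nr)%:E)%E.
  apply: hoelderG => //; first exact: mk.
    by move=> s _; exact: powR_ge0.
  apply: le_trans (integral_kernel_le (ltW tt') (lexx _) c0) _.
  by rewrite lee_fin subrr (@powR0 _ c) ?gt_eqF// subr0.
have kom : (\int[leb]_(s in `[0%R, t]) (k s * om (t' - t))%:E
    <= (T `^ theta / theta * om (t' - t))%:E)%E.
  have th : 1 - (1 - theta) * 1 = theta by ring.
  have th0' : 0 < 1 - (1 - theta) * 1 by rewrite th.
  under eq_integral do rewrite EFinM.
  rewrite ge0_integralZr.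
  - rewrite EFinM lee_wpmul2r// ?lee_fin//.
    have -> : (\int[leb]_(s in `[0%R, t]) (k s)%:E
        = \int[leb]_(s in `[0%R, t]) (k s `^ 1)%:E)%E.
      by apply: eq_integral => s _; rewrite powRr1 ?powR_ge0.
    apply: le_trans (integral_kernel_le t0 (lexx t) th0') _; rewrite th subrr subr0 (@powR0 _ theta) ?gt_eqF// subr0.
    by rewrite lee_fin ler_pM2r ?invr_gt0// ge0_ler_powR ?nnegrE// ltW.
  - exact: measurable_itv_lebR.
  - apply/measurable_EFinP; exact: mk.
  - by move=> s _; rewrite lee_fin powR_ge0.
  - by rewrite lee_fin.
have U : `[0, t']%classic = `[0, t]%classic `|` `]t, t']%classic :> set (@lebR R).
  apply/seteqP; split => s; rewrite /= !in_itv/=.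
    by move=> /andP[-> ->]; case: (leP s t) => _; [left|right].
  by move=> [/andP[-> /le_trans]|/andP[ts ->]]; [apply; exact: ltW|rewrite (le_trans t0)// ltW].
have intF'U : leb.-integrable `[0, t'] (EFin \o (fun s : R => k' s * F t' s)).
  by apply: intF; rewrite t'0.
have intF' : leb.-integrable `[0, t] (EFin \o (fun s : R => k' s * F t' s)).
  apply: integrableS intF'U; [exact: measurable_itv_lebR..|].
  by rewrite U; exact: subsetUl.
have mF' : measurable_fun (`]t, t'] : set (@lebR R)) (fun s : @lebR R => k' s * F t' s).
  have := measurable_int _ intF'U => /measurable_EFinP.
  apply: measurable_funS; first exact: measurable_itv_lebR.
  by rewrite U; exact: subsetUr.
have -> : Rintegral leb `[0, t'] (fun s => k' s * F t' s)
    = Rintegral leb `[0, t] (fun s => k' s * F t' s)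
      + Rintegral leb `]t, t'] (fun s => k' s * F t' s).
  rewrite [in LHS]U Rintegral_setU//.
  - by rewrite -U.
  - apply/disj_setPS => s [] /=; rewrite !in_itv/= => /andP[_ st] /andP[ts _].
    by have := lt_le_trans ts st; rewrite ltxx.
rewrite addrAC; apply: le_trans (ler_normD _ _) _.
have B1 : `|Rintegral leb `]t, t'] (fun s => k' s * F t' s)| <= H `^ q^-1 * Nr.
  have sU : `]t, t'] `<=` (`[t, t'] : set (@lebR R)).
    by move=> s /=; rewrite !in_itv/= => /andP[/ltW -> ->].
  have mg : measurable_fun (`[t, t'] : set (@lebR R)) (fun s : @lebR R => k' s * G s).
    by apply: measurable_funM; [exact: mk|exact: mGt].
  apply: (@le_integral_integrable _ (@lebR R) R leb _ _ (fun s => k' s * G s) _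
    (measurable_itv_lebR _) mF' _ _ _).2.
  - by apply: measurable_funS mg.
  - move=> s /=; rewrite in_itv/= => /andP[ts st'].
    rewrite normrM ger0_norm ?powR_ge0// ler_wpM2l ?powR_ge0// FG//.
    by rewrite (le_trans t0)// ltW.
  - apply: le_trans k'G; apply: ge0_subset_integral => //.
    + exact/measurable_EFinP.
    + move=> s /=; rewrite in_itv/= => /andP[ts st'].
      by rewrite lee_fin mulr_ge0 ?powR_ge0// G0// (le_trans t0 ts) (le_trans st').
have B2 : `|Rintegral leb `[0, t] (fun s => k' s * F t' s)
   - Rintegral leb `[0, t] (fun s => k s * F t s)|
   <= H `^ q^-1 * Nr + T `^ theta / theta * om (t' - t).
  have intFt : leb.-integrable `[0, t] (EFin \o (fun s : R => k s * F t s)).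
    by apply: intF; rewrite t0.
  rewrite -RintegralB//.
  have mkG : measurable_fun (`[0, t] : set (@lebR R)) (fun s : @lebR R => `|k s - k' s| * G s).
    by apply: measurable_funM => //; exact: mGt.
  have mko : measurable_fun (`[0, t] : set (@lebR R)) (fun s : @lebR R => k s * om (t' - t)).
    by apply: measurable_funM => //; exact: mk.
  apply: (@le_integral_integrable _ (@lebR R) R leb _ _
    (fun s => `|k s - k' s| * G s + k s * om (t' - t)) _ (measurable_itv_lebR _) _ _ _ _).2.
  - apply: measurable_funB.
      by have := measurable_int _ intF' => /measurable_EFinP.
    by have := measurable_int _ intFt => /measurable_EFinP.
  - exact: measurable_funD.
  - move=> s /=; rewrite in_itv/= => /andP[s0 st].
    (* Separates the change of kernel, with F taken at t', from the change of F, with the kernel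
       taken at t. *)
    have -> : k' s * F t' s - k s * F t s
        = - (k s - k' s) * F t' s + k s * (F t' s - F t s) by ring.
    apply: le_trans (ler_normD _ _) _; rewrite !normrM normrN; apply: lerD.
      by rewrite ler_wpM2l// FG// (le_trans st)// ltW.
    by rewrite [`|k s|]ger0_norm ?powR_ge0// ler_wpM2l ?powR_ge0// Fom.
  - under eq_integral do rewrite EFinD.
    rewrite ge0_integralD.
    + by rewrite EFinD leeD.
    + exact: measurable_itv_lebR.
    + move=> s /=; rewrite in_itv/= => /andP[s0 st].
      by rewrite lee_fin mulr_ge0// G0// s0 (le_trans st).
    + exact/measurable_EFinP.
    + by move=> s _; rewrite lee_fin mulr_ge0 ?powR_ge0.
    + exact/measurable_EFinP.
apply: le_trans (lerD B2 B1) _; rewrite HE.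
have e1 : 0 <= (t' - t) `^ (c / q) by exact: powR_ge0.
have e2 : 0 <= c^-1 `^ q^-1 * Nr by rewrite mulr_ge0 ?powR_ge0.
have e3 : 0 <= T `^ theta / theta by rewrite divr_ge0 ?powR_ge0// ltW.
move: e1 e2 e3 omh; move: (_ `^ (c / q)) (c^-1 `^ _) (_ / theta) (om _) => x y z w.
move=> x0 yN z0 w0; rewrite -subr_ge0.
(* The claimed product exceeds the sum of the three bounds exactly by nonnegative cross terms. *)
have -> : (2 * (y * Nr) + z) * (x + w) - (x * y * Nr + z * w + x * y * Nr)
    = 2 * (y * Nr * w) + z * x by ring.
by apply: addr_ge0; apply: mulr_ge0 => //; exact: mulr_ge0.
Qed.

(** * Fields with Lipschitz, growth and time-modulus bounds *)

(** The properties shared by f and g, stated for one field so that each estimate is proved once. The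
    Lipschitz bound compares states under the same control value; the effect of changing the control
    is carried by [gap]. *)
Record controlled_field (R : realType) (n d : nat) (T : R) (U : set 'rV[R]_d)
    (K0 K om : R -> R) (f : R -> R -> 'rV[R]_n -> 'rV[R]_d -> 'rV[R]_n) : Prop :=
  ControlledField {
    controlled_meas : measurable_field T U f;
    controlled_lip : forall t s x x' u, Delta T (t, s) -> U u ->
      enorm (f t s x u - f t s x' u) <= K s * enorm (x - x');
    controlled_zero : forall t s u, Delta T (t, s) -> U u ->
      enorm (f t s 0 u) <= K0 s;
    controlled_mod : forall t t' s x u, Delta T (t, s) -> Delta T (t', s) -> U u ->
      enorm (f t s x u - f t' s x u) <= om `|t - t'| * (1 + enorm x) }.

Definition control (R : realType) (d : nat) (T : R) (U : set 'rV[R]_d)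
    (u : R -> 'rV[R]_d) : Prop :=
  (forall t, 0 <= t <= T -> U (u t)) /\
  measurable_fun (`[0, T] : set (@lebR R)) (u : @lebR R -> borel_rV d).

Lemma subset_itv0 (R : realType) (t T : R) : t <= T ->
  `[0, t] `<=` (`[0, T] : set (@lebR R)).
Proof. by move=> tT s /=; rewrite !in_itv/= => /andP[-> /le_trans]; apply. Qed.

Lemma singular_integrandE (R : realType) (n d : nat) (theta : R)
    (f : R -> R -> 'rV[R]_n -> 'rV[R]_d -> 'rV[R]_n) x u t s i :
  singular_integrand theta f x u t s ord0 i
  = (t - s) `^ (theta - 1) * f t s (x s) (u s) ord0 i.
Proof. by rewrite /singular_integrand mxE -powRN opprB. Qed.

(** The identity holds also at s = t, where 0 to the power 0 is 1; it lets every estimate with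
    parameter theta cover g at theta = 1. *)
Lemma regular_integrandE (R : realType) (n d : nat)
    (g : R -> R -> 'rV[R]_n -> 'rV[R]_d -> 'rV[R]_n) x u t :
  regular_integrand g x u t = singular_integrand 1 g x u t.
Proof.
by apply/funext => s; rewrite /singular_integrand subrr powRr0 invr1 scale1r.
Qed.

(** The inner integral of [singular_gap]; at theta = 1 the denominator is 1 and it is the inner
    integral of [regular_gap]. *)
Definition gap (R : realType) (n d : nat) (theta : R)
    (f : R -> R -> 'rV[R]_n -> 'rV[R]_d -> 'rV[R]_n) x u u' (t : R) : \bar R :=
  (\int[leb]_(s in `[0%R, t])
     (enorm (f t s (x s) (u s) - f t s (x s) (u' s)) / (t - s) `^ (1 - theta))%:E)%E.

Section Field.
Context {R : realType} {n d : nat} {T : R} {U : set 'rV[R]_d} {K0 K om : R -> R}.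
Context {f : R -> R -> 'rV[R]_n -> 'rV[R]_d -> 'rV[R]_n}.
Hypothesis hf : controlled_field T U K0 K om f.
Implicit Types (x : R -> 'rV[R]_n) (u : R -> 'rV[R]_d).

Lemma controlled_growth t s v z i : Delta T (t, s) -> U z ->
  `|f t s v z ord0 i| <= K0 s + K s * enorm v.
Proof.
move=> ts Uz.
have -> : f t s v z ord0 i = f t s 0 z ord0 i + (f t s v z - f t s 0 z) ord0 i.
  by rewrite !mxE addrCA subrr addr0.
apply: le_trans (ler_normD _ _) _; apply: lerD.
  exact: le_trans (normr_coord_le_enorm _ _) (controlled_zero hf ts Uz).
apply: le_trans (normr_coord_le_enorm _ _) _.
by have := controlled_lip hf v 0 ts Uz; rewrite subr0.
Qed.

Lemma measurable_controlled x u t i :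
  {within `[0, T], continuous x} -> control T U u -> 0 <= t <= T ->
  measurable_fun (`[0, t] : set (@lebR R))
    (fun s : @lebR R => f t s (x s) (u s) ord0 i).
Proof.
move=> cx [Uu mu] /andP[t0 tT].
apply: (measurable_field_comp (tau := fun=> t : @lebR R) (sigma := id)
  (X := x) (V := u) i (controlled_meas hf)) => //.
- by apply: measurable_funS (measurable_continuous_path cx) => //; exact: subset_itv0.
- by apply: measurable_funS mu => //; exact: subset_itv0.
- move=> s /=; rewrite in_itv/= => /andP[s0 st]; split; last first.
    by apply: Uu; rewrite s0 (le_trans st).
  by split.
Qed.

Lemma measurable_enorm_path (x : R -> 'rV[R]_n) t :
  {within `[0, T], continuous x} -> t <= T ->
  measurable_fun (`[0, t] : set (@lebR R)) (fun s : @lebR R => enorm (x s)).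
Proof.
move=> cx tT; apply: measurable_enorm => i.
have mx : measurable_fun (`[0, T] : set (@lebR R)) (fun s : @lebR R => x s ord0 i).
  exact: (measurableT_comp (measurable_coord i) (measurable_continuous_path cx)).
by apply: measurable_funS mx => //; exact: subset_itv0.
Qed.

Lemma measurable_gap theta x u u' :
  {within `[0, T], continuous x} -> control T U u -> control T U u' ->
  measurable_fun (`[0, T] : set (@lebR R)) (gap theta f x u u' : @lebR R -> \bar R).
Proof.
move=> cx [Uu mu] [Uu' mu'].
pose E : set (@lebR R * @lebR R) := [set z | Delta T z].
have mfst : measurable_fun setT (fst : @lebR R * @lebR R -> @lebR R) by [].
have idR : measurable_fun [set: @lebR R] (id : @lebR R -> R).
  by move=> _ B mB; rewrite setTI; exact: Borel_lebR.
have mf1 : measurable_fun setT (fun z : @lebR R * @lebR R => z.1 : R).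
  exact: (measurableT_comp idR measurable_fst).
have mf2 : measurable_fun setT (fun z : @lebR R * @lebR R => z.2 : R).
  exact: (measurableT_comp idR measurable_snd).
have mE : measurable E.
  rewrite (_ : E = [set z : @lebR R * @lebR R | (0 : R) <= z.2]
    `&` [set z : @lebR R * @lebR R | (z.2 : R) <= z.1]
    `&` [set z : @lebR R * @lebR R | (z.1 : R) <= T]); last first.
    by apply/seteqP; split => z /= [] => [? ? ?|[? ?] ?].
  apply: measurableI; [apply: measurableI|].
  - by have := measurable_fun_le measurableT (measurable_cst (0 : R)) mf2; rewrite setTI.
  - by have := measurable_fun_le measurableT mf2 mf1; rewrite setTI.
  - by have := measurable_fun_le measurableT mf1 (measurable_cst T); rewrite setTI.
have E2 z : E z -> `[0, T]%classic z.2.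
  by case=> z2 z21 z1; rewrite /= in_itv/= z2 (le_trans z21).
have mcomp d' (Y : measurableType d') (v : @lebR R -> Y) :
    measurable_fun (`[0, T] : set (@lebR R)) v ->
    measurable_fun E (fun z : @lebR R * @lebR R => v z.2).
  move=> mv; apply: (@measurable_comp _ _ _ _ _ _ (`[0, T] : set (@lebR R)) v) => //.
    by move=> _ [z Ez <-]; exact: E2.
  exact: measurable_funTS.
have mF (v : R -> 'rV[R]_d) i : control T U v -> measurable_fun E
    (fun z : @lebR R * @lebR R => f z.1 z.2 (x z.2) (v z.2) ord0 i).
  move=> [Uv mv]; apply: (measurable_field_comp (tau := fst) (sigma := snd)
    (X := fun z => x z.2) (V := fun z => v z.2) i (controlled_meas hf)).
  - exact: measurable_funTS.
  - exact: measurable_funTS.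
  - exact: mcomp (measurable_continuous_path cx).
  - exact: mcomp mv.
  - move=> z Ez; split; first by case: z Ez.
    by apply: Uv; have := E2 _ Ez; rewrite /= in_itv.
pose H (z : @lebR R * @lebR R) : \bar R :=
  ((enorm (f z.1 z.2 (x z.2) (u z.2) - f z.1 z.2 (x z.2) (u' z.2))
     / ((z.1 : R) - z.2) `^ (1 - theta))%:E).
have mH : measurable_fun E H.
  apply/measurable_EFinP; apply: measurable_funM.
    apply: measurable_enorm => i.
    rewrite (_ : (fun z => _) = fun z : @lebR R * @lebR R =>
       f z.1 z.2 (x z.2) (u z.2) ord0 i - f z.1 z.2 (x z.2) (u' z.2) ord0 i).
      by apply: measurable_funB; exact: mF.
    by apply/funext => z; rewrite !mxE.
  rewrite (_ : (fun z => _) = fun z : @lebR R * @lebR R => ((z.1 : R) - z.2) `^ (theta - 1)).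
    apply: (measurableT_comp (measurable_powR _)).
    by apply: measurable_funB; exact: measurable_funTS.
  by apply/funext => z; rewrite -powRN opprB.
have mHE : measurable_fun setT (H \_ E) by apply/(measurable_restrictT _ mE).
have HE0 z : (0 <= (H \_ E) z)%E.
  rewrite patchE; case: ifPn => // _.
  by rewrite lee_fin divr_ge0 ?enorm_ge0 ?powR_ge0.
(* By Tonelli the integral in s of the integrand, extended by 0 off the triangle, is measurable in
   t. For t in [0, T] the section of the triangle is [0, t], so this integral is the gap. *)
have mG : measurable_fun (`[0, T] : set (@lebR R)) (fubini_F leb (H \_ E)).
  exact: measurable_funTS (@measurable_fun_fubini_tonelli_F _ _ (@lebR R) (@lebR R) R leb _ mHE HE0).
apply: eq_measurable_fun mG => t /set_mem/=; rewrite in_itv/= => /andP[t0 tT].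
rewrite /fubini_F /gap [RHS]integral_mkcond; apply: eq_integral => s _.
rewrite !patchE; congr (if _ then _ else _).
apply/idP/idP => /set_mem.
  by move=> [/= s0 st _]; apply/mem_set; rewrite /= in_itv/= s0.
by move=> /=; rewrite in_itv/= => /andP[s0 st]; apply/mem_set.
Qed.
End Field.

(** * Nonnegative functions in L^r(0, T) *)

Definition nonneg_Lp (R : realType) (T r : R) (h : R -> R) : Prop :=
  [/\ measurable_fun (`[0, T] : set (@lebR R)) (h : @lebR R -> R),
      forall s, 0 <= s <= T -> 0 <= h s &
      (\int[leb]_(s in `[0%R, T]) (h s `^ r)%:E < +oo)%E].

Lemma measurable_leb_powR (R : realType) (r : R) (D : set (@lebR R)) (h : R -> R) :
  measurable_fun D (h : @lebR R -> R) ->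
  measurable_fun D (fun s : @lebR R => (h s `^ r)%:E).
Proof.
by move=> mh; apply/measurable_EFinP; apply: (measurableT_comp (measurable_powR _)).
Qed.

Lemma ge0_integral_powR (R : realType) (r : R) (D : set R) (h : R -> R) :
  (0 <= \int[leb]_(s in D) (h s `^ r)%:E)%E.
Proof. by apply: integral_ge0 => s _; rewrite lee_fin powR_ge0. Qed.

(** On a bounded interval h^r <= 1 + h^r' is integrable. *)
Lemma nonneg_Lp_le (R : realType) (T r r' : R) (h : R -> R) : 0 <= T ->
  0 < r <= r' -> nonneg_Lp T r' h -> nonneg_Lp T r h.
Proof.
move=> T0 /andP[r0 rr'] [mh h0 hr]; split => //.
apply: (@le_lt_trans _ _ (\int[leb]_(s in `[0%R, T]) (cst 1%:E s + (h s `^ r')%:E))%E).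
  apply: ge0_le_integral.
  - exact: measurable_itv_lebR.
  - by move=> s _; rewrite lee_fin powR_ge0.
  - exact: measurable_leb_powR.
  - by apply: emeasurable_funD; [exact: measurable_cst|exact: measurable_leb_powR].
  - move=> s /=; rewrite in_itv/= => /h0 hs; rewrite lee_fin.
    have [h1|h1] := leP (h s) 1.
      apply: (@le_trans _ _ (1 `^ r)); last by rewrite powR1 lerDl powR_ge0.
      by rewrite ge0_ler_powR ?nnegrE// ltW.
    apply: (@le_trans _ _ (h s `^ r')); last by rewrite lerDr.
    by apply: ler_powR => //; exact: ltW.
rewrite ge0_integralD//.
- rewrite lte_add_pinfty// integral_cst// mul1e.
  by have := ltry (T - 0); rewrite -(leb_itvcc T0); apply.
- by move=> s _; rewrite lee_fin powR_ge0.
- exact: measurable_leb_powR.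
Qed.

(** The sum is at most twice the larger term, so its r-th power is at most the sum of the r-th
    powers of the doubled terms. *)
Lemma nonneg_Lp_comb (R : realType) (T r X : R) (h1 h2 : R -> R) :
  0 < r -> 0 <= X -> nonneg_Lp T r h1 -> nonneg_Lp T r h2 ->
  nonneg_Lp T r (fun s => h1 s + h2 s * X).
Proof.
move=> r0 X0 [m1 p1 i1] [m2 p2 i2]; split.
- apply: measurable_funD => //; exact: measurable_funM.
- by move=> s sT; rewrite addr_ge0 ?p1// mulr_ge0 ?p2.
have c0 : 0 <= (2 * X) `^ r by exact: powR_ge0.
apply: (@le_lt_trans _ _ (\int[leb]_(s in `[0%R, T])
    ((2 `^ r)%:E * (h1 s `^ r)%:E + ((2 * X) `^ r)%:E * (h2 s `^ r)%:E))%E).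
  apply: ge0_le_integral.
  - exact: measurable_itv_lebR.
  - by move=> s _; rewrite lee_fin powR_ge0.
  - apply: measurable_leb_powR; apply: measurable_funD => //.
    exact: measurable_funM.
  - by apply: emeasurable_funD; apply: measurable_funeM; exact: measurable_leb_powR.
  - move=> s /=; rewrite in_itv/= => sT; rewrite -!EFinM -EFinD lee_fin.
    have a0 := p1 s sT; have b0 := p2 s sT.
    rewrite -!powRM// ?mulr_ge0//.
    have [ab|ab] := leP (h1 s) (h2 s * X).
      apply: (@le_trans _ _ ((2 * X * h2 s) `^ r)); last by rewrite lerDr powR_ge0.
      rewrite ge0_ler_powR ?nnegrE ?addr_ge0 ?mulr_ge0 ?(ltW r0)//.
      by rewrite -mulrA (mulrC X) mulr2n mulrDl mul1r lerD2r.
    apply: (@le_trans _ _ ((2 * h1 s) `^ r)); last by rewrite lerDl powR_ge0.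
    rewrite ge0_ler_powR ?nnegrE ?addr_ge0 ?mulr_ge0 ?(ltW r0)//.
    by rewrite mulr2n mulrDl mul1r lerD2l ltW.
rewrite ge0_integralD//; first last.
- by apply: measurable_funeM; exact: measurable_leb_powR.
- by move=> s _; rewrite -EFinM lee_fin mulr_ge0 ?powR_ge0.
- by apply: measurable_funeM; exact: measurable_leb_powR.
- by move=> s _; rewrite -EFinM lee_fin mulr_ge0 ?powR_ge0.
rewrite !ge0_integralZl//; try exact: measurable_leb_powR;
  try (by move=> s _; rewrite lee_fin powR_ge0); try by rewrite lee_fin powR_ge0.
by rewrite lte_add_pinfty// lte_mul_pinfty// lee_fin powR_ge0.
Qed.

Lemma memLp_nonneg_Lp (R : realType) (T r : R) (h : R -> R) : r != 0 ->
  (forall s, 0 <= s <= T -> 0 <= h s) -> memLp T r h -> nonneg_Lp T r h.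
Proof.
move=> r0 h0 hr; have mh := sub_Lfun_mfun hr; have fh := sub_Lfun_finLfun hr.
split=> //.
  apply/(measurable_restrictT _ (measurable_itv_lebR _)).
  by move: mh; rewrite inE.
move: fh; rewrite inE/= /finite_norm unlock => /lty_poweRy.
rewrite invr_eq0 => /(_ r0); apply: le_lt_trans.
rewrite [leLHS]integral_mkcond le_eqVlt; apply/orP; left; apply/eqP.
apply: eq_integral => s _.
rewrite /= !patchE; case: ifPn => [|_].
  by move=> /set_mem/=; rewrite in_itv/= => /h0 hs; rewrite ger0_norm.
by rewrite normr0 powR0.
Qed.

(** With q conjugate to r, the integrability condition (1 - theta) q < 1 is the same as 1/r <
    theta. *)
Lemma hoelder_exponent (R : realType) (theta r : R) : theta <= 1 -> 0 < r ->
  r^-1 < theta ->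
  let q := (1 - r^-1)^-1 in
  [/\ 0 < q, q^-1 + r^-1 = 1 & 0 < 1 - (1 - theta) * q].
Proof.
move=> th1 r0 rth q.
have q0 : 0 < 1 - r^-1 by lra.
split; rewrite ?invr_gt0// /q ?invrK ?subrK//.
by rewrite subr_gt0 ltr_pdivrMr// mul1r; lra.
Qed.

(** * Continuity and difference estimates for one integral operator *)

Section Field.
Context {R : realType} {n d : nat} {T : R} {U : set 'rV[R]_d} {K0 K om : R -> R}.
Context {f : R -> R -> 'rV[R]_n -> 'rV[R]_d -> 'rV[R]_n}.
Hypothesis hf : controlled_field T U K0 K om f.
Hypothesis T0 : 0 <= T.
Implicit Types (x : R -> 'rV[R]_n) (u : R -> 'rV[R]_d) (theta r : R).

(** Applies [volterra_modulus] to each coordinate of the field along a path. Both e and C depend on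
    the path only through its bound X. *)
Lemma volterra_continuity theta r X : 0 < theta <= 1 -> 0 < r -> r^-1 < theta ->
  nonneg_Lp T r K0 -> nonneg_Lp T r K -> (forall h, 0 <= h -> 0 <= om h) -> 0 <= X ->
  exists2 e, 0 < e & exists2 C, 0 <= C & forall x u,
    {within `[0, T], continuous x} -> control T U u ->
    (forall t, 0 <= t <= T -> enorm (x t) <= X) ->
    (forall t, 0 <= t <= T -> vintegrable `[0, t] (singular_integrand theta f x u t)) /\
    (forall t t' i, 0 <= t -> t < t' -> t' <= T ->
      `|vintegral `[0, t'] (singular_integrand theta f x u t') ord0 i
        - vintegral `[0, t] (singular_integrand theta f x u t) ord0 i|
      <= C * ((t' - t) `^ e + om (t' - t))).
Proof.
move=> th r0 rth K0r Kr om0 X0.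
have [q0 qr c0] := hoelder_exponent (proj2 (andP th)) r0 rth.
set q := (1 - r^-1)^-1 in q0 qr c0.
(* Along a path bounded by X the field is dominated by G = K0 + K X, and (A2) gives its time modulus
   as [om] times 1 + X. *)
have [mG G0 Gr] := nonneg_Lp_comb r0 X0 K0r Kr.
have omX0 h : 0 <= h -> 0 <= om h * (1 + X).
  by move=> h0; rewrite mulr_ge0 ?om0// addr_ge0.
have [C C0 HC] := volterra_modulus T0 th c0 q0 r0 qr mG G0 Gr omX0.
exists ((1 - (1 - theta) * q) / q); first by rewrite divr_gt0.
exists (C * (1 + X)); first by rewrite mulr_ge0 ?addr_ge0.
move=> x u cx hu xX.
have D t s : 0 <= s -> s <= t -> t <= T -> Delta T (t, s) /\ U (u s).
  by move=> s0 st tT; split => //; apply: hu.1; rewrite s0 (le_trans st).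
have H i := HC (fun t s => f t s (x s) (u s) ord0 i).
have {}H i : (forall t, 0 <= t <= T -> leb.-integrable `[0, t]
       (fun s : R => ((t - s) `^ (theta - 1) * f t s (x s) (u s) ord0 i)%:E)) /\
    (forall t t', 0 <= t -> t < t' -> t' <= T ->
       `|Rintegral leb `[0, t'] (fun s => (t' - s) `^ (theta - 1) * f t' s (x s) (u s) ord0 i)
         - Rintegral leb `[0, t] (fun s => (t - s) `^ (theta - 1) * f t s (x s) (u s) ord0 i)|
       <= C * ((t' - t) `^ ((1 - (1 - theta) * q) / q) + om (t' - t) * (1 + X))).
  apply: H.
  - by move=> t tT; exact: (measurable_controlled hf).
  - move=> t s s0 st tT; have [Dts Us] := D t s s0 st tT.
    apply: le_trans (controlled_growth hf _ _ Dts Us) _.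
    rewrite lerD2l ler_wpM2l//; last by apply: xX; rewrite s0 (le_trans st).
    by case: Kr => _ + _; apply; rewrite s0 (le_trans st).
  - move=> t t' s s0 st tt' t'T.
    have [Dts Us] := D t s s0 st (le_trans (ltW tt') t'T).
    have [Dt's _] := D t' s s0 (le_trans st (ltW tt')) t'T.
    have := normr_coord_le_enorm (f t' s (x s) (u s) - f t s (x s) (u s)) i.
    rewrite !mxE => /le_trans; apply.
    apply: le_trans (controlled_mod hf _ Dt's Dts Us) _.
    rewrite gtr0_norm ?subr_gt0// ler_wpM2l ?om0 ?subr_ge0 ?(ltW tt')//.
    by rewrite lerD2l xX// s0 (le_trans st)// (le_trans (ltW tt')).
split.
  move=> t tT i; have := (H i).1 t tT.
  by apply: eq_integrable => // s _; rewrite singular_integrandE.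
move=> t t' i t0 tt' t'T.
have E a : vintegral `[0, a] (singular_integrand theta f x u a) ord0 i
    = Rintegral leb `[0, a] (fun s => (a - s) `^ (theta - 1) * f a s (x s) (u s) ord0 i).
  by rewrite mxE; apply: eq_Rintegral => s _; exact: singular_integrandE.
rewrite !E.
apply: le_trans ((H i).2 t t' t0 tt' t'T) _.
rewrite -mulrA ler_wpM2l// [leRHS]mulrDr; apply: lerD; last by rewrite mulrC.
by rewrite ler_peMl ?powR_ge0// lerDl.
Qed.

Lemma measurable_gap_integrand theta x u u' t :
  {within `[0, T], continuous x} -> control T U u -> control T U u' -> 0 <= t <= T ->
  measurable_fun (`[0, t] : set (@lebR R)) (fun s : @lebR R =>
    enorm (f t s (x s) (u s) - f t s (x s) (u' s)) / (t - s) `^ (1 - theta)).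
Proof.
move=> cx hu hu' tT; apply: measurable_funM.
  apply: measurable_enorm => i.
  rewrite (_ : (fun z => _) = fun s : @lebR R =>
     f t s (x s) (u s) ord0 i - f t s (x s) (u' s) ord0 i).
    by apply: measurable_funB; exact: (measurable_controlled hf).
  by apply/funext => z; rewrite !mxE.
rewrite (_ : (fun z => _) = fun s : @lebR R => (t - s) `^ (theta - 1)).
  exact: measurable_kernel (measurable_itv _).
by apply/funext => z; rewrite -powRN opprB.
Qed.

Lemma measurable_enormB x x' t : {within `[0, T], continuous x} ->
  {within `[0, T], continuous x'} -> t <= T ->
  measurable_fun (`[0, t] : set (@lebR R)) (fun s : @lebR R => enorm (x s - x' s)).
Proof.
move=> cx cx' tT; apply: measurable_enorm => i.
rewrite (_ : (fun z => _) = fun s : @lebR R => x s ord0 i - x' s ord0 i).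
  have mx (y : R -> 'rV[R]_n) : {within `[0, T], continuous y} ->
      measurable_fun (`[0, t] : set (@lebR R)) (fun s : @lebR R => y s ord0 i).
    move=> cy; have my := measurableT_comp (measurable_coord i) (measurable_continuous_path cy).
    by apply: measurable_funS my => //; exact: subset_itv0.
  by apply: measurable_funB; exact: mx.
by apply/funext => z; rewrite !mxE.
Qed.

Hypothesis mK : measurable_fun (`[0, T] : set (@lebR R)) (K : @lebR R -> R).
Hypothesis K_ge0 : forall s, 0 <= s <= T -> 0 <= K s.

Lemma measurable_kernelM theta t (w : R -> R) : 0 <= t <= T ->
  measurable_fun (`[0, t] : set (@lebR R)) (w : @lebR R -> R) ->
  measurable_fun (`[0, t] : set (@lebR R))
    (fun s : @lebR R => (t - s) `^ (theta - 1) * K s * w s).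
Proof.
move=> /andP[t0 tT] mw; apply: measurable_funM => //; apply: measurable_funM.
  exact: measurable_kernel (measurable_itv _).
by apply: measurable_funS mK => //; exact: subset_itv0.
Qed.

Lemma le_vintegral_coord theta x u x' u' t i (g1 g2 : R -> R) :
  vintegrable `[0, t] (singular_integrand theta f x u t) ->
  vintegrable `[0, t] (singular_integrand theta f x' u' t) ->
  measurable_fun (`[0, t] : set (@lebR R)) (g1 : @lebR R -> R) ->
  measurable_fun (`[0, t] : set (@lebR R)) (g2 : @lebR R -> R) ->
  (forall s, 0 <= s <= t -> 0 <= g1 s) -> (forall s, 0 <= s <= t -> 0 <= g2 s) ->
  (forall s, 0 <= s <= t ->
     (t - s) `^ (theta - 1) * `|f t s (x s) (u s) ord0 i - f t s (x' s) (u' s) ord0 i|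
     <= g1 s + g2 s) ->
  (`|vintegral `[0, t] (singular_integrand theta f x u t) ord0 i
     - vintegral `[0, t] (singular_integrand theta f x' u' t) ord0 i|%:E
   <= \int[leb]_(s in `[0%R, t]) (g1 s)%:E + \int[leb]_(s in `[0%R, t]) (g2 s)%:E)%E.
Proof.
move=> /(_ i) ix /(_ i) ix' m1 m2 p1 p2 fg; rewrite !mxE.
rewrite -RintegralB//.
have i12 : (0 <= \int[leb]_(s in `[0%R, t]) (g1 s + g2 s)%:E)%E.
  by apply: integral_ge0 => s /=; rewrite in_itv/= lee_fin => ts; rewrite addr_ge0 ?p1 ?p2.
rewrite -ge0_integralD//; first last.
- exact/measurable_EFinP.
- exact/measurable_EFinP.
under [leRHS]eq_integral do rewrite -EFinD.
have [->|fin] := eqVneq (\int[leb]_(s in `[0%R, t]) (g1 s + g2 s)%:E)%E +oo%E.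
  exact: leey.
rewrite -[leRHS]fineK; last by rewrite ge0_fin_numE// ltey.
rewrite lee_fin.
apply: (@le_integral_integrable _ (@lebR R) R leb _ _ (fun s => g1 s + g2 s) _
    (measurable_itv_lebR _) _ _ _ _).2.
- by apply: measurable_funB; apply/measurable_EFinP; [exact: measurable_int ix|exact: measurable_int ix'].
- exact: measurable_funD.
- move=> s /=; rewrite in_itv/= => ts; rewrite !singular_integrandE -mulrBr normrM.
  by rewrite ger0_norm ?powR_ge0// fg.
- by rewrite fineK// ge0_fin_numE// ltey.
Qed.

(** The intermediate value f(t, s, x(s), u'(s)) separates the change of control, which yields the
    gap along x, from the change of state, which the Lipschitz bound turns into K |x - x'|. *)
Lemma volterra_diff theta x u x' u' t i :
  {within `[0, T], continuous x} -> {within `[0, T], continuous x'} ->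
  control T U u -> control T U u' -> 0 <= t <= T ->
  vintegrable `[0, t] (singular_integrand theta f x u t) ->
  vintegrable `[0, t] (singular_integrand theta f x' u' t) ->
  (`|vintegral `[0, t] (singular_integrand theta f x u t) ord0 i
     - vintegral `[0, t] (singular_integrand theta f x' u' t) ord0 i|%:E
   <= gap theta f x u u' t
      + \int[leb]_(s in `[0%R, t])
          ((t - s) `^ (theta - 1) * K s * enorm (x s - x' s))%:E)%E.
Proof.
move=> cx cx' hu hu' /[dup] tT' /andP[t0 tT] ix ix'.
have sT s : 0 <= s <= t -> 0 <= s <= T by move=> /andP[-> /le_trans]; apply.
apply: le_vintegral_coord => //.
- exact: measurable_gap_integrand.
- by apply: measurable_kernelM => //; exact: measurable_enormB.
- by move=> s _; rewrite divr_ge0 ?enorm_ge0 ?powR_ge0.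
- by move=> s /sT sT'; rewrite mulr_ge0 ?enorm_ge0// mulr_ge0 ?powR_ge0 ?K_ge0.
- move=> s st; have sT' := sT s st; case/andP: st => s0 st.
  have Dts : Delta T (t, s) by split.
  rewrite [_ / _]mulrC -powRN opprB -mulrA -mulrDr ler_wpM2l ?powR_ge0//.
  have -> : f t s (x s) (u s) ord0 i - f t s (x' s) (u' s) ord0 i
      = (f t s (x s) (u s) - f t s (x s) (u' s)) ord0 i
        + (f t s (x s) (u' s) - f t s (x' s) (u' s)) ord0 i.
    by rewrite !mxE; ring.
  apply: le_trans (ler_normD _ _) _; apply: lerD; first exact: normr_coord_le_enorm.
  apply: le_trans (normr_coord_le_enorm _ _) _.
  by apply: (controlled_lip hf) => //; exact: hu'.1.
Qed.
End Field.

(** * Powers of sums and geometric convergence *)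

Lemma ge0_le_poweR (R : realType) (x y : \bar R) (e : R) : 0 <= e ->
  (0 <= x)%E -> (x <= y)%E -> (x `^ e <= y `^ e)%E.
Proof.
move=> e0 x0 xy; apply: gt0_ler_poweR; rewrite ?in_itv/= ?leey ?andbT//.
exact: le_trans xy.
Qed.

(** The sum is at most three times the largest term, and the power of the largest term is one of the
    summands on the right. This works for every e > 0, hence for exponents below 1 too. *)
Lemma poweR_add3_le (R : realType) (x y z : \bar R) (e : R) : 0 < e ->
  (0 <= x -> 0 <= y -> 0 <= z ->
   (x + (y + z)) `^ e <= (3 `^ e)%:E * (x `^ e + (y `^ e + z `^ e)))%E.
Proof.
move=> e0 x0 y0 z0.
have H m : (0 <= m -> x <= m -> y <= m -> z <= m ->
    m `^ e <= x `^ e + (y `^ e + z `^ e) ->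
    (x + (y + z)) `^ e <= (3 `^ e)%:E * (x `^ e + (y `^ e + z `^ e)))%E.
  move=> m0 xm ym zm me.
  apply: (@le_trans _ _ ((3%:E * m) `^ e)%E).
    apply: ge0_le_poweR; [exact: ltW|by rewrite !adde_ge0|].
    apply: (@le_trans _ _ (m + (m + m))%E); first by rewrite !leeD.
    rewrite (_ : 3%:E = 1 + (1 + 1))%E; last by rewrite -!EFinD; congr EFin; ring.
    by rewrite !ge0_muleDl ?mul1e// ?lee_fin.
  by rewrite poweRM ?lee_fin// poweR_EFin lee_pmul2l// lte_fin powR_gt0.
have [xy|yx] := leP x y; [have [yz|zy] := leP y z|have [xz|zx] := leP x z].
- by apply: (H z) => //; [exact: le_trans yz|rewrite addeA leeDr// adde_ge0 ?poweR_ge0].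
- apply: (H y) => //; first exact: ltW.
  by rewrite addeCA leeDl// adde_ge0 ?poweR_ge0.
- apply: (H z) => //; first exact: le_trans (ltW yx) xz.
  by rewrite addeA leeDr// adde_ge0 ?poweR_ge0.
- apply: (H x) => //; [exact: ltW|exact: ltW|].
  by rewrite leeDl// adde_ge0 ?poweR_ge0.
Qed.

Lemma LpnormE (R : realType) (T p : R) (h : R -> R) : p != 0 ->
  (forall t, 0 <= t <= T -> 0 <= h t) ->
  Lpnorm T p h = ((\int[leb]_(t in `[0%R, T]) (h t `^ p)%:E) `^ p^-1)%E.
Proof.
move=> p0 h0; rewrite /Lpnorm unlock; congr (_ `^ _)%E.
rewrite [RHS]integral_mkcond; apply: eq_integral => s _.
rewrite /= !patchE; case: ifPn => [|_].
  by move=> /set_mem/=; rewrite in_itv/= => /h0 hs; rewrite ger0_norm.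
by rewrite normr0 powR0.
Qed.

(** With e_k the tail of the geometric series, every a_k - e_k lies below every a_j + e_j. The
    supremum of the lower bounds is then the limit, with explicit rate e_k. *)
Lemma geometric_limit (R : realType) (a : nat -> R) (D rho : R) :
  0 <= D -> 0 <= rho < 1 -> (forall k, `|a k.+1 - a k| <= D * rho ^+ k) ->
  exists l, forall k, `|l - a k| <= D * rho ^+ k / (1 - rho).
Proof.
move=> D0 /andP[r0 r1] aD.
have r1' : 0 < 1 - rho by rewrite subr_gt0.
pose e k := D * rho ^+ k / (1 - rho).
have e0 k : 0 <= e k by rewrite divr_ge0 ?mulr_ge0 ?exprn_ge0// ltW.
have eS k : D * rho ^+ k + e k.+1 = e k.
  by rewrite /e exprS; field; rewrite gt_eqF.
have H m k : `|a (k + m)%N - a k| <= e k.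
  elim: m k => [|m IH] k; first by rewrite addn0 subrr normr0.
  rewrite addnS -addSn -(subrK (a k.+1) (a (k.+1 + m)%N)) -addrA -eS addrC.
  by apply: le_trans (ler_normD _ _) _; rewrite lerD.
have ub k j : a k - e k <= a j + e j.
  have [kj|/ltnW jk] := leqP k j.
    have := H (j - k)%N k; rewrite subnKC// ler_norml => /andP[h _].
    by have := e0 j; lra.
  have := H (k - j)%N j; rewrite subnKC// ler_norml => /andP[_ h].
  by have := e0 k; lra.
pose L := [set a k - e k | k in [set: nat]].
have L0 : L !=set0 by exists (a 0%N - e 0%N); exists 0%N.
have hL : has_sup L by split => //; exists (a 0%N + e 0%N) => _ [k _ <-]; exact: ub.
exists (sup L) => k; rewrite -/(e k) ler_norml; apply/andP; split.
  have : a k - e k <= sup L by apply: sup_upper_bound => //; exists k.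
  by lra.
have : sup L <= a k + e k by apply: ge_sup => // _ [j _ <-]; exact: ub.
by lra.
Qed.

Lemma le0_of_geometric (R : realType) (y C rho : R) : 0 <= rho < 1 ->
  (forall k, y <= C * rho ^+ k) -> y <= 0.
Proof.
move=> /andP[r0 r1] yC.
have : C * rho ^+ k @[k --> \oo] --> C * 0.
  by apply: cvgM; [exact: cvg_cst|apply: cvg_expr; rewrite ger0_norm].
rewrite mulr0 => /cvgr_to_ge; apply.
by apply: nearW.
Qed.

(** * From a singular inequality to Gronwall for p-th powers *)

Section PowerBound.
Context {R : realType} (n : nat) {T alpha p r : R} {K : R -> R}.
Hypotheses (T0 : 0 <= T) (alpha01 : 0 < alpha <= 1) (p1 : 1 < p) (r0 : 0 < r)
  (rp : r^-1 + p^-1 < alpha) (Kr : nonneg_Lp T r K).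

Lemma volterra_power_bound : exists2 B, 0 < B &
  forall (t y : R) (w : R -> R) (a : \bar R), 0 <= t <= T ->
    measurable_fun (`[0, t] : set (@lebR R)) (w : @lebR R -> R) ->
    (forall s, 0 <= s <= t -> 0 <= w s) -> 0 <= y -> (0 <= a)%E ->
    (y%:E <= n%:R%:E *
      (a + (\int[leb]_(s in `[0%R, t]) ((t - s) `^ (alpha - 1) * K s * w s)%:E
          + \int[leb]_(s in `[0%R, t]) ((t - s) `^ (1 - 1) * K s * w s)%:E)))%E ->
    ((y `^ p)%:E <= B%:E * a `^ p
      + B%:E * \int[leb]_(s in `[0%R, t]) (w s `^ p)%:E)%E.
Proof.
have p0 : 0 < p by apply: lt_trans p1.
have /andP[al0 al1] := alpha01.
have ir : 0 < r^-1 by rewrite invr_gt0.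
have ip : 0 < p^-1 by rewrite invr_gt0.
have rp' := rp.
have iq : 0 < 1 - p^-1 - r^-1 by lra.
pose q := (1 - p^-1 - r^-1)^-1.
have q0 : 0 < q by rewrite invr_gt0.
have pqr : p^-1 + (q^-1 + r^-1) = 1 by rewrite /q invrK; lra.
(* As 1/q = 1 - 1/p - 1/r, this is the assumption 1/r + 1/p < alpha rewritten; the same q serves for
   the kernel with theta = 1. *)
have c1 : 0 < 1 - (1 - alpha) * q.
  by rewrite subr_gt0 ltr_pdivrMr// mul1r; lra.
have c2 : 0 < 1 - (1 - 1) * q by rewrite subrr mul0r subr0.
have [mK K0 Kfin] := Kr.
have [B1 B10 HB1] := kernel_hoelder T0 p1 c1 q0 r0 pqr mK K0 Kfin.
have [B2 B20 HB2] := kernel_hoelder T0 p1 c2 q0 r0 pqr mK K0 Kfin.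
have N0 : 0 <= n%:R `^ p * 3 `^ p by rewrite mulr_ge0 ?powR_ge0.
(* n^p comes from the prefactor n, 3^p from splitting a sum of three terms, B1 and B2 from Hoelder
   with each kernel; the last 1 keeps the constant positive. *)
exists (n%:R `^ p * 3 `^ p * (1 + B1 + B2) + 1).
  by rewrite ltr_wpDl// mulr_ge0// !addr_ge0// ltW.
move=> t y w a tT mw w0 y0 a0 yle.
set I1 := (X in (a + (X + _))%E) in yle.
set I2 := (X in (a + (_ + X))%E) in yle.
have {}HB1 : (I1 `^ p <= B1%:E * \int[leb]_(s in `[0%R, t]) (w s `^ p)%:E)%E by exact: HB1.
have {}HB2 : (I2 `^ p <= B2%:E * \int[leb]_(s in `[0%R, t]) (w s `^ p)%:E)%E by exact: HB2.
have kw0 e s : `[0, t]%classic s -> (0 <= ((t - s) `^ e * K s * w s)%:E)%E.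
  rewrite /= in_itv/= => /[dup] st /andP[s0 st'].
  rewrite lee_fin mulr_ge0 ?w0// mulr_ge0 ?powR_ge0// K0// s0 (le_trans st')//.
  by case/andP: tT.
have I10 : (0 <= I1)%E by apply: integral_ge0; exact: kw0.
have I20 : (0 <= I2)%E by apply: integral_ge0; exact: kw0.
set W := (\int[leb]_(s in `[0%R, t]) (w s `^ p)%:E)%E in HB1 HB2 *.
have W0 : (0 <= W)%E by exact: ge0_integral_powR.
have ap0 : (0 <= a `^ p)%E by exact: poweR_ge0.
have H : ((y `^ p)%:E <= (n%:R `^ p * 3 `^ p)%:E * (a `^ p + (B1%:E * W + B2%:E * W)))%E.
  rewrite -poweR_EFin; apply: le_trans (ge0_le_poweR (ltW p0) _ yle) _ => //.
  have aI0 : (0 <= a + (I1 + I2))%E by apply: adde_ge0 => //; exact: adde_ge0.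
  rewrite poweRM ?lee_fin//.
  rewrite (_ : n%:R%:E `^ p = (n%:R `^ p)%:E)%E; last by rewrite poweR_EFin.
  rewrite EFinM -muleA.
  rewrite lee_wpmul2l ?lee_fin ?powR_ge0//.
  apply: le_trans (poweR_add3_le p0 a0 I10 I20) _.
  by rewrite lee_wpmul2l ?lee_fin ?powR_ge0// leeD2l// leeD.
apply: le_trans H _.
set N := (n%:R `^ p * 3 `^ p) in N0 *.
rewrite -ge0_muleDl ?lee_fin ?(ltW B10) ?(ltW B20)// -EFinD ge0_muleDr//; last first.
  by rewrite mule_ge0// lee_fin addr_ge0// ltW.
rewrite muleA -EFinM; apply: leeD.
  rewrite lee_wpmul2r// lee_fin.
  apply: (@le_trans _ _ (N * (1 + B1 + B2))); last by rewrite lerDl.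
  by rewrite ler_peMr// -addrA lerDl addr_ge0// ltW.
rewrite lee_wpmul2r// lee_fin.
apply: (@le_trans _ _ (N * (1 + B1 + B2))); last by rewrite lerDl.
by rewrite ler_wpM2l// -addrA lerDr.
Qed.

(** [gronwall] with v = w^p and A = B a^p; the bound M on w enters only through finiteness, so C
    does not depend on it. *)
Lemma Lp_gronwall : exists2 C, 0 <= C &
  forall (w : R -> R) (M : R) (a : R -> \bar R),
    measurable_fun (`[0, T] : set (@lebR R)) (w : @lebR R -> R) ->
    (forall t, 0 <= t <= T -> 0 <= w t <= M) ->
    measurable_fun (`[0, T] : set (@lebR R)) (a : @lebR R -> \bar R) ->
    (forall t, 0 <= t <= T -> (0 <= a t)%E) ->
    {ae leb, forall t : R, 0 <= t <= T -> ((w t)%:E <= n%:R%:E *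
      (a t + (\int[leb]_(s in `[0%R, t]) ((t - s) `^ (alpha - 1) * K s * w s)%:E
          + \int[leb]_(s in `[0%R, t]) ((t - s) `^ (1 - 1) * K s * w s)%:E)))%E} ->
    (\int[leb]_(s in `[0%R, T]) (w s `^ p)%:E
       <= C%:E * \int[leb]_(s in `[0%R, T]) (a s `^ p))%E.
Proof.
have p0 : 0 < p by apply: lt_trans p1.
have [B B0 HB] := volterra_power_bound.
exists (2 * expR (2 * B * T) * B).
  by rewrite !mulr_ge0 ?expR_ge0// ltW.
move=> w M a mw wM ma a0 wa.
have map : measurable_fun (`[0, T] : set (@lebR R)) (fun t : @lebR R => (a t `^ p)%E).
  exact: (measurableT_comp (measurable_poweR _)).
rewrite EFinM -muleA -ge0_integralZl//; last 2 first.
- by move=> s _; rewrite poweR_ge0.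
- by rewrite lee_fin ltW.
apply: (@gronwall _ T B (M `^ p) (fun s => w s `^ p) (fun s => B%:E * a s `^ p)%E) => //.
- by apply/measurable_EFinP; exact: measurable_leb_powR.
- exact: measurable_funeM.
- move=> t tT; have /andP[wt0 wtM] := wM t tT.
  rewrite powR_ge0/= ge0_ler_powR ?nnegrE ?(ltW p0)//.
  exact: le_trans wtM.
- by move=> t tT; rewrite mule_ge0 ?poweR_ge0// lee_fin ltW.
- apply: (@filterS _ _ (@ae_filter_ringOfSetsType _ (@lebR R) R leb) _ _ _ wa).
  move=> t + tT => /(_ tT) wt; apply: HB => //.
  + by apply: measurable_funS mw => //; apply: subset_itv0; case/andP: tT.
  + move=> s /andP[s0 st]; have [|//] := andP (wM s _).
    by rewrite s0 (le_trans st)//; case/andP: tT.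
  + by have /andP[] := wM t tT.
  + exact: a0.
- by rewrite T0 lexx.
Qed.
End PowerBound.

(** * From coordinates to norms, almost everywhere to everywhere, and sums in L^p *)

Lemma normr_Rintegral_leD (R : realType) (t : R) (h g1 g2 : R -> R) :
  leb.-integrable `[0, t] (EFin \o h : @lebR R -> \bar R) ->
  measurable_fun (`[0, t] : set (@lebR R)) (g1 : @lebR R -> R) ->
  measurable_fun (`[0, t] : set (@lebR R)) (g2 : @lebR R -> R) ->
  (forall s, 0 <= s <= t -> 0 <= g1 s) -> (forall s, 0 <= s <= t -> 0 <= g2 s) ->
  (forall s, 0 <= s <= t -> `|h s| <= g1 s + g2 s) ->
  (`|Rintegral leb `[0, t] h|%:E
   <= \int[leb]_(s in `[0%R, t]) (g1 s)%:E + \int[leb]_(s in `[0%R, t]) (g2 s)%:E)%E.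
Proof.
move=> ih m1 m2 p1 p2 fg.
have i12 : (0 <= \int[leb]_(s in `[0%R, t]) (g1 s + g2 s)%:E)%E.
  by apply: integral_ge0 => s /=; rewrite in_itv/= lee_fin => ts; rewrite addr_ge0 ?p1 ?p2.
rewrite -ge0_integralD//; first last.
- exact/measurable_EFinP.
- exact/measurable_EFinP.
under [leRHS]eq_integral do rewrite -EFinD.
have [->|fin] := eqVneq (\int[leb]_(s in `[0%R, t]) (g1 s + g2 s)%:E)%E +oo%E.
  exact: leey.
rewrite -[leRHS]fineK; last by rewrite ge0_fin_numE// ltey.
rewrite lee_fin.
apply: (@le_integral_integrable _ (@lebR R) R leb _ _ (fun s => g1 s + g2 s) _
    (measurable_itv_lebR _) _ _ _ _).2.
- by apply/measurable_EFinP; exact: measurable_int ih.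
- exact: measurable_funD.
- by move=> s /=; rewrite in_itv/= => ts; rewrite fg.
- by rewrite fineK// ge0_fin_numE// ltey.
Qed.

(** For Z = +oo and n = 0 the right-hand side is 0, and the bound holds because an empty row has
    norm 0. *)
Lemma enorm_le_ecoord (R : realType) (n : nat) (v : 'rV[R]_n) (Z : \bar R) :
  (0 <= Z -> (forall i, `|v ord0 i|%:E <= Z) -> (enorm v)%:E <= n%:R%:E * Z)%E.
Proof.
case: Z => [z|_ _|//].
  move=> _ vz; rewrite -EFinM lee_fin mulr_natl; apply: enorm_le_coord => i.
  by rewrite -lee_fin.
case: n v => [|n] v.
  rewrite mul0e lee_fin; apply: le_trans (enorm_le_sum v) _.
  by rewrite big_ord0.
by rewrite gt0_muley ?leey// lte_fin ltr0n.
Qed.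

Lemma enormB_bounded (R : realType) (n : nat) (T : R) (x y : R -> 'rV[R]_n) :
  0 <= T -> {within `[0, T], continuous x} -> {within `[0, T], continuous y} ->
  exists2 M, 0 <= M & forall t, 0 <= t <= T -> enorm (x t - y t) <= M.
Proof.
move=> T0 cx cy.
have [X X0 xX] := continuous_enorm_bounded T0 cx.
have [Y Y0 yY] := continuous_enorm_bounded T0 cy.
exists ((X + Y) *+ n) => [|t tT]; first by rewrite mulrn_wge0// addr_ge0.
apply: enorm_le_coord => i; rewrite !mxE; apply: le_trans (ler_normB _ _) _.
apply: lerD; apply: le_trans (normr_coord_le_enorm _ _) _; [exact: xX|exact: yY].
Qed.

Lemma continuous_path_of_coord (R : realType) (n : nat) (T : R) (x : R -> 'rV[R]_n) :
  (forall t, 0 <= t <= T -> forall e, 0 < e -> exists2 del, 0 < del &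
    forall s i, 0 <= s <= T -> `|t - s| < del -> `|x t ord0 i - x s ord0 i| <= e) ->
  {within `[0, T], continuous x}.
Proof.
move=> H; apply/continuous_pathP => t tT e e0.
have e' : 0 < e / n.+1%:R by rewrite divr_gt0.
have [del del0 Hdel] := H t tT _ e'; exists del => // s sT ts.
apply: le_trans (enorm_le_coord (M := e / n.+1%:R) _) _.
  by move=> i; rewrite !mxE; exact: Hdel.
rewrite -[leLHS]mulr_natr -mulrA ler_piMr ?(ltW e0)// mulrC ler_pdivrMr// mul1r ler_nat.
exact: leqnSn.
Qed.

Lemma integral_powR_bound (R : realType) (t p X : R) (w : R -> R) : 0 <= t -> 0 <= p ->
  measurable_fun (`[0, t] : set (@lebR R)) (w : @lebR R -> R) ->
  (forall s, 0 <= s <= t -> 0 <= w s <= X) ->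
  (\int[leb]_(s in `[0%R, t]) (w s `^ p)%:E <= (X `^ p * t)%:E)%E.
Proof.
move=> t0 p0 mw wX.
apply: (@le_trans _ _ (\int[leb]_(s in `[0%R, t]) (cst (X `^ p)%:E s))%E).
  apply: ge0_le_integral.
  - exact: measurable_itv_lebR.
  - by move=> s _; rewrite lee_fin powR_ge0.
  - exact: measurable_leb_powR.
  - exact: measurable_cst.
  - move=> s /=; rewrite in_itv/= => /wX/andP[w0 wX'].
    by rewrite lee_fin ge0_ler_powR ?nnegrE// (le_trans w0).
rewrite integral_cst// EFinM lee_wpmul2l ?lee_fin ?powR_ge0//.
by have := leb_itvcc t0; rewrite subr0 => <-.
Qed.

Lemma gap0 (R : realType) (n d : nat) (theta : R)
    (f : R -> R -> 'rV[R]_n -> 'rV[R]_d -> 'rV[R]_n) x u t :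
  gap theta f x u u t = 0%E.
Proof.
rewrite /gap; under eq_integral do rewrite subrr enorm0 mul0r.
by rewrite integral0.
Qed.

Lemma gap_ge0 (R : realType) (n d : nat) (theta : R)
    (f : R -> R -> 'rV[R]_n -> 'rV[R]_d -> 'rV[R]_n) x u u' t :
  (0 <= gap theta f x u u' t)%E.
Proof.
by apply: integral_ge0 => s _; rewrite lee_fin divr_ge0 ?enorm_ge0 ?powR_ge0.
Qed.

Lemma continuous_path_ae_eq (R : realType) (n : nat) (T : R) (x y : R -> 'rV[R]_n) :
  0 < T -> {within `[0, T], continuous x} -> {within `[0, T], continuous y} ->
  {ae leb, forall t : R, 0 <= t <= T -> x t = y t} ->
  forall t, 0 <= t <= T -> x t = y t.
Proof.
move=> T0 cx cy xy t tT; apply/rowP => i; apply/eqP.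
rewrite -subr_eq0 -normr_le0; apply/ler_addgt0Pr => e e0; rewrite add0r.
have e2 : 0 < e / 2 by rewrite divr_gt0.
have /continuous_pathP/(_ t tT _ e2)[d1 d10 H1] := cx.
have /continuous_pathP/(_ t tT _ e2)[d2 d20 H2] := cy.
have d0 : 0 < Num.min d1 d2 by rewrite lt_min d10.
have [s [sT + xys]] := ae_dense T0 xy tT d0; rewrite lt_min => /andP[sd1 sd2].
have := le_trans (normr_coord_le_enorm _ i) (H1 s sT sd1).
have := le_trans (normr_coord_le_enorm _ i) (H2 s sT sd2).
rewrite !mxE xys => h2 h1.
have -> : x t ord0 i - y t ord0 i
   = (x t ord0 i - y s ord0 i) - (y t ord0 i - y s ord0 i) by ring.
by apply: le_trans (ler_normB _ _) _; lra.
Qed.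

(** A triangle inequality in L^p up to a constant, obtained from [poweR_add3_le] used under the
    integral with exponent p and outside it with exponent 1/p; this gives the factor 3 times
    3^(1/p). *)
Lemma Lp_norm_add3_le (R : realType) (T p c : R) (phi psi : R -> \bar R) :
  0 <= T -> 0 < p -> 0 <= c ->
  measurable_fun (`[0, T] : set (@lebR R)) (phi : @lebR R -> \bar R) ->
  measurable_fun (`[0, T] : set (@lebR R)) (psi : @lebR R -> \bar R) ->
  (forall t, 0 <= phi t)%E -> (forall t, 0 <= psi t)%E ->
  ((\int[leb]_(t in `[0%R, T]) ((c%:E + (phi t + psi t)) `^ p)) `^ p^-1
   <= (3 * 3 `^ p^-1)%:E * ((T `^ p^-1 * c)%:E
       + ((\int[leb]_(t in `[0%R, T]) (phi t `^ p)) `^ p^-1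
          + (\int[leb]_(t in `[0%R, T]) (psi t `^ p)) `^ p^-1)))%E.
Proof.
move=> T0 p0 c0 mphi mpsi phi0 psi0.
have ip : 0 < p^-1 by rewrite invr_gt0.
have mp (h : R -> \bar R) : measurable_fun (`[0, T] : set (@lebR R)) (h : @lebR R -> \bar R) ->
    measurable_fun (`[0, T] : set (@lebR R)) (fun t : @lebR R => h t `^ p)%E.
  by move=> mh; exact: (measurableT_comp (measurable_poweR _)).
have I0 (h : R -> \bar R) : (0 <= \int[leb]_(t in `[0%R, T]) (h t `^ p))%E.
  by apply: integral_ge0 => t _; exact: poweR_ge0.
have mD : measurable_fun (`[0, T] : set (@lebR R))
    (fun t : @lebR R => phi t `^ p + psi t `^ p)%E.
  by apply: emeasurable_funD; exact: mp.
have mc : measurable_fun (`[0, T] : set (@lebR R)) (fun=> c%:E `^ p : \bar R)%E.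
  exact: measurable_cst.
have cT : (\int[leb]_(t in `[0%R, T]) (c%:E `^ p) <= (c `^ p * T)%:E)%E.
  apply: (@integral_powR_bound _ T p c (fun=> c) T0 (ltW p0)).
    exact: measurable_cst.
  by move=> s _; rewrite lexx c0.
have step : (\int[leb]_(t in `[0%R, T]) ((c%:E + (phi t + psi t)) `^ p)
    <= (3 `^ p)%:E * ((c `^ p * T)%:E + (\int[leb]_(t in `[0%R, T]) (phi t `^ p)
       + \int[leb]_(t in `[0%R, T]) (psi t `^ p))))%E.
  apply: (@le_trans _ _ (\int[leb]_(t in `[0%R, T])
      ((3 `^ p)%:E * (c%:E `^ p + (phi t `^ p + psi t `^ p))))%E).
    apply: ge0_le_integral.
    - exact: measurable_itv_lebR.
    - by move=> t _; exact: poweR_ge0.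
    - apply: (mp (fun t => c%:E + (phi t + psi t))%E).
      by apply: emeasurable_funD; [exact: measurable_cst|exact: emeasurable_funD].
    - by apply: measurable_funeM; exact: emeasurable_funD.
    - by move=> t _; apply: poweR_add3_le.
  rewrite ge0_integralZl; first last.
  - by rewrite lee_fin powR_ge0.
  - by move=> t _; rewrite !adde_ge0 ?poweR_ge0.
  - exact: emeasurable_funD.
  - exact: measurable_itv_lebR.
  rewrite lee_wpmul2l ?lee_fin ?powR_ge0// ge0_integralD; first last.
  - exact: mD.
  - by move=> t _; rewrite !adde_ge0 ?poweR_ge0.
  - exact: mc.
  - by move=> t _; exact: poweR_ge0.
  - exact: measurable_itv_lebR.
  rewrite leeD// ge0_integralD; first by [].
  - exact: measurable_itv_lebR.
  - by move=> t _; exact: poweR_ge0.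
  - exact: mp.
  - by move=> t _; exact: poweR_ge0.
  - exact: mp.
apply: le_trans (ge0_le_poweR (ltW ip) _ step) _; first exact: (I0 (fun t => c%:E + (phi t + psi t))%E).
have cT0 : (0 <= (c `^ p * T)%:E)%E by rewrite lee_fin mulr_ge0 ?powR_ge0.
have S0 : (0 <= (c `^ p * T)%:E + (\int[leb]_(t in `[0%R, T]) (phi t `^ p)
       + \int[leb]_(t in `[0%R, T]) (psi t `^ p)))%E.
  by apply: adde_ge0 => //; apply: adde_ge0; exact: I0.
rewrite poweRM ?lee_fin ?powR_ge0//.
have -> : ((3 `^ p)%:E `^ p^-1 = 3%:E :> \bar R)%E.
  by rewrite poweR_EFin -powRrM mulfV ?gt_eqF// powRr1.
rewrite [in leRHS](EFinM 3) -muleA lee_wpmul2l ?lee_fin//.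
apply: le_trans (poweR_add3_le ip cT0 (I0 phi) (I0 psi)) _.
rewrite lee_wpmul2l ?lee_fin ?powR_ge0// leeD2r//.
by rewrite poweR_EFin lee_fin powRM ?powR_ge0// -powRrM mulfV ?gt_eqF// powRr1// mulrC.
Qed.

(** * The Volterra map: fixed points, stability, uniqueness, growth *)

Section Equation.
Context {R : realType} {n d : nat} {T alpha p r r' : R} {U : set 'rV[R]_d}.
Context {K0 K om : R -> R} {f g : R -> R -> 'rV[R]_n -> 'rV[R]_d -> 'rV[R]_n}.
Hypotheses (T_gt0 : 0 < T) (alpha_gt0 : 0 < alpha) (alpha_le1 : alpha <= 1)
  (p1 : 1 < p) (r0 : 0 < r) (rp : r^-1 + p^-1 < alpha)
  (Kr : nonneg_Lp T r K) (r'0 : 0 < r') (r'a : r'^-1 < alpha)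
  (K0r' : nonneg_Lp T r' K0) (Kr' : nonneg_Lp T r' K)
  (om0 : forall h, 0 <= h -> 0 <= om h) (om_cvg : om h @[h --> 0^'+] --> (0 : R))
  (hf : controlled_field T U K0 K om f) (hg : controlled_field T U K0 K om g).
Implicit Types (x : R -> 'rV[R]_n) (u : R -> 'rV[R]_d).

Let T0 : 0 <= T := ltW T_gt0.
Let p0 : 0 < p := lt_trans ltr01 p1.
Let alpha01 : 0 < alpha <= 1. Proof. by rewrite alpha_gt0. Qed.
Let one01 : 0 < (1 : R) <= 1. Proof. by rewrite ltr01 lexx. Qed.
Let r'1 : r'^-1 < 1. Proof. exact: lt_le_trans alpha_le1. Qed.
Let mK : measurable_fun (`[0, T] : set (@lebR R)) (K : @lebR R -> R).
Proof. by case: Kr. Qed.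
Let K_ge0 s : 0 <= s <= T -> 0 <= K s.
Proof. by case: Kr => _ + _; apply. Qed.

(** The right-hand side of the equation as an operator on paths. Two exponents are at work: [r]
    pairs K with functions in L^p, while [r'] pairs K0 and K with bounded paths. *)
Definition volterra_map (x0 : 'rV[R]_n) u x (t : R) : 'rV[R]_n :=
  x0 + vintegral `[0, t] (singular_integrand alpha f x u t)
     + vintegral `[0, t] (singular_integrand 1 g x u t).

Lemma volterra_integrable x u : {within `[0, T], continuous x} -> control T U u ->
  forall t, 0 <= t <= T ->
  vintegrable `[0, t] (singular_integrand alpha f x u t) /\
  vintegrable `[0, t] (singular_integrand 1 g x u t).
Proof.
move=> cx hu t tT; have [X X0 xX] := continuous_enorm_bounded T0 cx.
have [e1 e10 [C1 C10 H1]] := volterra_continuity hf T0 alpha01 r'0 r'a K0r' Kr' om0 X0.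
have [e2 e20 [C2 C20 H2]] := volterra_continuity hg T0 one01 r'0 r'1 K0r' Kr' om0 X0.
by split; [apply: (H1 x u cx hu xX).1|apply: (H2 x u cx hu xX).1].
Qed.

Lemma continuous_volterra_map (x0 : 'rV[R]_n) x u :
  {within `[0, T], continuous x} -> control T U u ->
  {within `[0, T], continuous (volterra_map x0 u x)}.
Proof.
move=> cx hu; have [X X0 xX] := continuous_enorm_bounded T0 cx.
have [e1 e10 [C1 C10 H1]] := volterra_continuity hf T0 alpha01 r'0 r'a K0r' Kr' om0 X0.
have [e2 e20 [C2 C20 H2]] := volterra_continuity hg T0 one01 r'0 r'1 K0r' Kr' om0 X0.
have {}H1 := (H1 x u cx hu xX).2; have {}H2 := (H2 x u cx hu xX).2.
(* A common modulus for all coordinates of the image path; it tends to 0 at 0 from the right. *)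
pose psi h := C1 * (h `^ e1 + om h) + C2 * (h `^ e2 + om h).
have psi0 : psi h @[h --> 0^'+] --> (0 : R).
  rewrite -[X in _ --> X](_ : C1 * (0 + 0) + C2 * (0 + 0) = 0); last by rewrite addr0 !mulr0 addr0.
  by apply: cvgD; (apply: cvgM; first exact: cvg_cst);
    (apply: cvgD => //; exact: powR_cvg0).
have H t t' i : 0 <= t -> t < t' -> t' <= T ->
    `|volterra_map x0 u x t' ord0 i - volterra_map x0 u x t ord0 i| <= psi (t' - t).
  move=> t0 tt' t'T; apply: le_trans (lerD (H1 t t' i t0 tt' t'T) (H2 t t' i t0 tt' t'T)).
  apply: le_trans (ler_normD _ _); rewrite /volterra_map.
  move: (vintegral _ _) (vintegral _ _) (vintegral _ _) (vintegral _ _) => a b c e.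
  by rewrite !mxE le_eqVlt; apply/orP; left; apply/eqP; congr `|_|; ring.
apply: continuous_path_of_coord => t tT e e0.
have : \forall h \near 0^'+, psi h <= e by exact: (cvgr_le _ psi0).
rewrite near_withinE => /nbhs_ballP[del /= del0 Hdel].
exists del => // s i sT ts.
have Hd h : 0 < h -> h < del -> psi h <= e.
  move=> h0 hdel; apply: Hdel => //=.
  by rewrite /ball/= sub0r normrN gtr0_norm.
have /andP[t0 tT'] := tT; have /andP[s0 sT'] := sT.
case: (ltgtP t s) ts => [ts|st|->].
- rewrite distrC gtr0_norm ?subr_gt0// => sd; rewrite distrC.
  by apply: le_trans (H _ _ _ t0 ts sT') _; apply: Hd => //; rewrite subr_gt0.
- rewrite gtr0_norm ?subr_gt0// => sd.
  by apply: le_trans (H _ _ _ s0 st tT') _; apply: Hd => //; rewrite subr_gt0.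
- by move=> _; rewrite subrr normr0 ltW.
Qed.

Lemma volterra_map_diff (x0 x0' : 'rV[R]_n) x x' u u' t :
  {within `[0, T], continuous x} -> {within `[0, T], continuous x'} ->
  control T U u -> control T U u' -> 0 <= t <= T ->
  ((enorm (volterra_map x0 u x t - volterra_map x0' u' x' t))%:E <= n%:R%:E *
    (((enorm (x0 - x0'))%:E + (gap alpha f x u u' t + gap 1 g x u u' t)) +
     (\int[leb]_(s in `[0%R, t])
          ((t - s) `^ (alpha - 1) * K s * enorm (x s - x' s))%:E
      + \int[leb]_(s in `[0%R, t])
          ((t - s) `^ (1 - 1) * K s * enorm (x s - x' s))%:E)))%E.
Proof.
move=> cx cx' hu hu' tT.
have [ix1 ix2] := volterra_integrable cx hu tT.
have [ix1' ix2'] := volterra_integrable cx' hu' tT.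
have int0 theta : (0 <= \int[leb]_(s in `[0%R, t])
    ((t - s) `^ (theta - 1) * K s * enorm (x s - x' s))%:E)%E.
  apply: integral_ge0 => s /=; rewrite in_itv/= => /andP[s0 st].
  rewrite lee_fin mulr_ge0 ?enorm_ge0// mulr_ge0 ?powR_ge0// K_ge0// s0 (le_trans st)//.
  by case/andP: tT.
apply: enorm_le_ecoord.
  apply: adde_ge0; last by apply: adde_ge0; exact: int0.
  apply: adde_ge0; first by rewrite lee_fin enorm_ge0.
  by apply: adde_ge0; exact: gap_ge0.
move=> i.
have h1 := volterra_diff hf mK K_ge0 i cx cx' hu hu' tT ix1 ix1'.
have h2 := volterra_diff hg mK K_ge0 i cx cx' hu hu' tT ix2 ix2'.
rewrite -addeA addeACA; apply: le_trans (leeD2l _ (leeD h1 h2)).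
rewrite -!EFinD lee_fin /volterra_map.
move: (vintegral _ _) (vintegral _ _) (vintegral _ _) (vintegral _ _) => e c b a.
have -> : (x0 + a + b - (x0' + c + e)) ord0 i
    = (x0 - x0') ord0 i + ((a ord0 i - c ord0 i) + (b ord0 i - e ord0 i)).
  by rewrite !mxE; ring.
apply: le_trans (ler_normD _ _) _; apply: lerD; first exact: normr_coord_le_enorm.
exact: ler_normD.
Qed.

(** Picard iteration from the constant path x0. The power bound with zero forcing acts as a
    contraction of factor 1/2 for p-th powers weighted by exp(-2 B t), so no restriction to short
    time intervals arises. *)
Lemma volterra_existence (x0 : 'rV[R]_n) u : control T U u ->
  exists2 x : R -> 'rV[R]_n, {within `[0, T], continuous x} &
    forall t, 0 <= t <= T -> x t = volterra_map x0 u x t.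
Proof.
move=> hu.
pose xs k := iter k (volterra_map x0 u) (fun=> x0).
have cxs k : {within `[0, T], continuous (xs k)}.
  elim: k => [|k IH]; last exact: continuous_volterra_map.
  by apply: continuous_subspaceT => t; exact: cst_continuous.
have [B B0 HB] := @volterra_power_bound R n T alpha p r K T0 alpha01 p1 r0 rp Kr.
have contract y y' t : {within `[0, T], continuous y} ->
    {within `[0, T], continuous y'} -> 0 <= t <= T ->
    ((enorm (volterra_map x0 u y t - volterra_map x0 u y' t) `^ p)%:E
      <= B%:E * \int[leb]_(s in `[0%R, t]) (enorm (y s - y' s) `^ p)%:E)%E.
  move=> cy cy' tT.
  have := HB t (enorm (volterra_map x0 u y t - volterra_map x0 u y' t))
    (fun s => enorm (y s - y' s)) 0%E tT.
  rewrite poweR0r ?gt_eqF// mule0 !add0e; apply => //.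
  - by apply: measurable_enormB => //; case/andP: tT.
  - by move=> s _; exact: enorm_ge0.
  - exact: enorm_ge0.
  - have := volterra_map_diff x0 x0 cy cy' hu hu tT.
    by rewrite !gap0 subrr enorm0 !add0e.
have [M M0 HM] := enormB_bounded T0 (cxs 1%N) (cxs 0%N).
pose w k t := enorm (xs k.+1 t - xs k t).
(* Each iteration gains 1/2, since B times the integral of exp(2 B s) over [0, t] is (exp(2 B t) -
   1) / 2. *)
have wk k t : 0 <= t <= T -> w k t `^ p <= M `^ p * 2^-1 ^+ k * expR (2 * B * t).
  elim: k t => [|k IH] t tT.
    rewrite expr0 mulr1; apply: (@le_trans _ _ (M `^ p)).
      by rewrite ge0_ler_powR ?nnegrE ?enorm_ge0 ?(ltW p0)//; exact: HM.
    rewrite ler_peMr ?powR_ge0// -[leLHS]expR0 ler_expR.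
    by case/andP: tT => t0 _; rewrite !mulr_ge0// ltW.
  have /andP[t0 tT'] := tT.
  have B2 : 0 < 2 * B by rewrite mulr_gt0.
  have N0 : 0 <= M `^ p * 2^-1 ^+ k by rewrite mulr_ge0 ?powR_ge0// exprn_ge0.
  rewrite -lee_fin; apply: le_trans (contract _ _ _ (cxs k.+1) (cxs k) tT) _.
  apply: (@le_trans _ _ (B%:E * \int[leb]_(s in `[0%R, t])
      ((M `^ p * 2^-1 ^+ k)%:E * (expR (2 * B * s))%:E))%E).
    rewrite lee_wpmul2l ?lee_fin ?(ltW B0)//; apply: ge0_le_integral.
    - exact: measurable_itv_lebR.
    - by move=> s _; rewrite lee_fin powR_ge0.
    - by apply: measurable_leb_powR; exact: measurable_enormB.
    - apply: measurable_funeM; apply/measurable_EFinP.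
      apply: Borel_lebR_fun; first exact: measurable_itv.
      by apply: measurable_funTS; apply: measurableT_comp => //.
    - move=> s /=; rewrite in_itv/= => /andP[s0 st]; rewrite -EFinM lee_fin.
      by apply: IH; rewrite s0 (le_trans st).
  rewrite ge0_integralZl; first last.
  - by rewrite lee_fin.
  - by move=> s _; rewrite lee_fin expR_ge0.
  - apply/measurable_EFinP; apply: Borel_lebR_fun; first exact: measurable_itv.
    by apply: measurable_funTS; apply: measurableT_comp => //.
  - exact: measurable_itv_lebR.
  rewrite integral_expR// -!EFinM lee_fin exprS.
  have -> : B * (M `^ p * 2^-1 ^+ k * ((expR (2 * B * t) - 1) / (2 * B)))
      = M `^ p * 2^-1 ^+ k * (2^-1 * (expR (2 * B * t) - 1)).
    by field; rewrite gt_eqF.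
  have -> : M `^ p * (2^-1 * 2^-1 ^+ k) * expR (2 * B * t)
      = M `^ p * 2^-1 ^+ k * (2^-1 * expR (2 * B * t)) by ring.
  by rewrite ler_wpM2l// ler_wpM2l// gerBl.
(* [rho] and [D] come from taking p-th roots in the weighted bound, with t replaced by T to be
   uniform. *)
pose rho := 2^-1 `^ p^-1 : R.
pose D := M * expR (2 * B * T) `^ p^-1.
have D0 : 0 <= D by rewrite mulr_ge0 ?powR_ge0.
have ip : 0 < p^-1 by rewrite invr_gt0.
have rho01 : 0 <= rho < 1.
  have : 2^-1 `^ p^-1 < 1 `^ p^-1 :> R.
    by rewrite gt0_ltr_powR ?nnegrE// invf_lt1// ltr1n.
  by rewrite powR1 powR_ge0.
have powK (z : R) : 0 <= z -> (z `^ p) `^ p^-1 = z.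
  by move=> z0; rewrite -powRrM mulfV ?gt_eqF// powRr1.
have wD k t : 0 <= t <= T -> w k t <= D * rho ^+ k.
  move=> tT; rewrite -(powK (w k t)) ?enorm_ge0//.
  have -> : D * rho ^+ k = (M `^ p * 2^-1 ^+ k * expR (2 * B * T)) `^ p^-1.
    rewrite !powRM ?mulr_ge0 ?powR_ge0 ?exprn_ge0 ?expR_ge0// powK//.
    by rewrite -(powR_mulrn k (_ : 0 <= 2^-1))// powRAC powR_mulrn ?powR_ge0// /D mulrAC.
  have N0 : 0 <= M `^ p * 2^-1 ^+ k by rewrite mulr_ge0 ?powR_ge0// exprn_ge0.
  apply: ge0_ler_powR; rewrite ?nnegrE ?powR_ge0 ?(ltW ip)//.
    by rewrite mulr_ge0 ?expR_ge0.
  apply: le_trans (wk k t tT) _; rewrite ler_wpM2l// ler_expR.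
  by case/andP: tT => t0 tT; rewrite ler_wpM2l// mulr_ge0// ltW.
(* Limits exist for each time and coordinate; outside [0, T] the condition is void, so choice gives
   one total function. *)
have lim (ti : R * 'I_n) : exists l, 0 <= ti.1 <= T ->
    forall k, `|l - xs k ti.1 ord0 ti.2| <= D * rho ^+ k / (1 - rho).
  have [tT|ntT] := boolP (0 <= ti.1 <= T); last by exists 0.
  have [|l lP] := @geometric_limit R (fun k => xs k ti.1 ord0 ti.2) D rho D0 rho01.
    move=> k; apply: le_trans (wD k _ tT).
    by have := normr_coord_le_enorm (xs k.+1 ti.1 - xs k ti.1) ti.2; rewrite !mxE.
  by exists l.
have [l lP] := choice lim.
pose x t := \row_i l (t, i).
have xP t i k : 0 <= t <= T -> `|x t ord0 i - xs k t ord0 i| <= D * rho ^+ k / (1 - rho).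
  by move=> tT; rewrite mxE; exact: lP.
have r1' : 0 < 1 - rho by case/andP: rho01; rewrite subr_gt0.
have cx : {within `[0, T], continuous x}.
  apply: continuous_path_of_coord => t tT e e0.
  have e3 : 0 < e / 3 by rewrite divr_gt0.
  have [k ke] : exists k, D * rho ^+ k / (1 - rho) <= e / 3.
    apply: contrapT => H.
    have : e / 3 <= 0.
      apply: (@le0_of_geometric _ _ (D / (1 - rho)) rho rho01) => k.
      by rewrite mulrAC; apply/ltW; rewrite ltNge; apply/negP => ?; apply: H; exists k.
    by rewrite leNgt e3.
  have /continuous_pathP/(_ t tT _ e3)[del del0 Hdel] := cxs k.
  exists del => // s i sT ts.
  have a := le_trans (xP t i k tT) ke; have b := le_trans (xP s i k sT) ke.
  have c : `|xs k t ord0 i - xs k s ord0 i| <= e / 3.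
    by have := le_trans (normr_coord_le_enorm _ i) (Hdel s sT ts); rewrite !mxE.
  have -> : x t ord0 i - x s ord0 i = (x t ord0 i - xs k t ord0 i)
     + ((xs k t ord0 i - xs k s ord0 i) - (x s ord0 i - xs k s ord0 i)) by ring.
  apply: le_trans (ler_normD _ _) _.
  have := ler_normB (xs k t ord0 i - xs k s ord0 i) (x s ord0 i - xs k s ord0 i).
  by lra.
exists x => // t tT.
apply/rowP => i; apply/eqP; rewrite -subr_eq0 -normr_le0.
(* The first term bounds the distance from x to the next iterate. The second bounds the distance
   between the images of x and of the k-th iterate, by the contraction estimate applied to the
   uniform error, with n from passing from coordinates to the norm. *)
pose C := D / (1 - rho) + (B * T) `^ p^-1 * (n%:R * (D / (1 - rho))).
apply: (@le0_of_geometric _ _ C rho rho01) => k.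
have -> : x t ord0 i - volterra_map x0 u x t ord0 i
    = (x t ord0 i - xs k.+1 t ord0 i)
      + (volterra_map x0 u (xs k) t - volterra_map x0 u x t) ord0 i.
  rewrite (_ : xs k.+1 t = volterra_map x0 u (xs k) t)//.
  move: (volterra_map x0 u (xs k) t) (volterra_map x0 u x t) => a b.
  by rewrite !mxE; ring.
apply: le_trans (ler_normD _ _) _; rewrite /C mulrDl; apply: lerD.
  apply: le_trans (xP t i k.+1 tT) _; rewrite mulrAC ler_wpM2l//.
    by rewrite divr_ge0// ltW.
  have /andP[rho0 /ltW rho1] := rho01.
  by rewrite exprS ler_piMl// exprn_ge0.
apply: le_trans (normr_coord_le_enorm _ _) _.
set z := enorm _.
set e := D * rho ^+ k / (1 - rho).
have e0 : 0 <= e.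
  by rewrite divr_ge0 ?(ltW r1')// mulr_ge0// exprn_ge0//; case/andP: rho01.
have -> : (B * T) `^ p^-1 * (n%:R * (D / (1 - rho))) * rho ^+ k
    = (B * T * (n%:R * e) `^ p) `^ p^-1.
  have BT0 : 0 <= B * T by rewrite mulr_ge0// ltW.
  have ne0 : 0 <= n%:R * e by rewrite mulr_ge0.
  by rewrite [RHS](powRM _ BT0 (powR_ge0 _ _)) (powK _ ne0) /e; ring.
rewrite -(powK z) ?enorm_ge0//.
apply: ge0_ler_powR; rewrite ?nnegrE ?powR_ge0 ?(ltW ip)//.
  by rewrite !mulr_ge0 ?powR_ge0 ?(ltW B0).
rewrite -lee_fin; apply: le_trans (contract _ _ _ (cxs k) cx tT) _.
have /andP[t0 tT'] := tT.
rewrite -mulrA EFinM lee_wpmul2l ?lee_fin ?(ltW B0)//.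
apply: le_trans (@integral_powR_bound _ t p (n%:R * e) _ t0 (ltW p0) _ _) _.
- exact: measurable_enormB.
- move=> s /andP[s0 st]; rewrite enorm_ge0/= mulr_natl; apply: enorm_le_coord => j.
  have sT : 0 <= s <= T by rewrite s0 (le_trans st).
  by have := xP s j k sT; rewrite !mxE distrC.
- by rewrite lee_fin mulrC ler_wpM2r ?powR_ge0.
Qed.

(** [Lp_gronwall] for w = |x - x'|, with forcing |x0 - x0'| plus the gaps along x. The constant
    precedes the data and is uniform in them. *)
Lemma volterra_stability : exists2 C, 0 <= C &
  forall (x0 x0' : 'rV[R]_n) u u' x x', control T U u -> control T U u' ->
    {within `[0, T], continuous x} -> {within `[0, T], continuous x'} ->
    {ae leb, forall t : R, 0 <= t <= T -> x t = volterra_map x0 u x t} ->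
    {ae leb, forall t : R, 0 <= t <= T -> x' t = volterra_map x0' u' x' t} ->
    (\int[leb]_(t in `[0%R, T]) (enorm (x t - x' t) `^ p)%:E
     <= C%:E * \int[leb]_(t in `[0%R, T]) (((enorm (x0 - x0'))%:E
          + (gap alpha f x u u' t + gap 1 g x u u' t)) `^ p))%E.
Proof.
have [C C0 HC] := @Lp_gronwall R n T alpha p r K T0 alpha01 p1 r0 rp Kr.
exists C => // x0 x0' u u' x x' hu hu' cx cx' ex ex'.
have [M M0 HM] := enormB_bounded T0 cx cx'.
apply: (HC (fun t => enorm (x t - x' t)) M).
- exact: measurable_enormB.
- by move=> t tT; rewrite enorm_ge0 HM.
- apply: emeasurable_funD; first exact: measurable_cst.
  by apply: emeasurable_funD; [exact: (measurable_gap hf)|exact: (measurable_gap hg)].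
- move=> t tT; apply: adde_ge0; first by rewrite lee_fin enorm_ge0.
  by apply: adde_ge0; exact: gap_ge0.
- apply: (@filterS2 _ _ (@ae_filter_ringOfSetsType _ (@lebR R) R leb) _ _ _ _ ex ex').
  move=> t xt xt' tT; rewrite {1}xt// {1}xt'//.
  exact: volterra_map_diff.
Qed.

(** With equal data the forcing in [volterra_stability] vanishes, so |x - y|^p has zero integral;
    continuity upgrades almost everywhere to everywhere. *)
Lemma volterra_uniqueness (x0 : 'rV[R]_n) u x y : control T U u ->
  {within `[0, T], continuous x} -> {within `[0, T], continuous y} ->
  {ae leb, forall t : R, 0 <= t <= T -> x t = volterra_map x0 u x t} ->
  {ae leb, forall t : R, 0 <= t <= T -> y t = volterra_map x0 u y t} ->
  forall t, 0 <= t <= T -> x t = y t.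
Proof.
move=> hu cx cy ex ey; apply: continuous_path_ae_eq => //.
have [C C0 HC] := volterra_stability.
have : (\int[leb]_(t in `[0%R, T]) `|(enorm (x t - y t) `^ p)%:E| = 0)%E.
  apply/eqP; rewrite eq_le; apply/andP; split; last exact: integral_ge0.
  under eq_integral do rewrite gee0_abs ?lee_fin ?powR_ge0//.
  apply: le_trans (HC _ _ _ _ _ _ hu hu cx cy ex ey) _.
  under eq_integral do rewrite !gap0 subrr enorm0 !adde0 poweR0r ?gt_eqF//.
  by rewrite integral0 mule0.
move=> /(ae_eq_integral_abs leb (measurable_itv_lebR _)) H.
have {H} := H (measurable_leb_powR _ (measurable_enormB cx cy (lexx T))).
apply: (@filterS _ _ (@ae_filter_ringOfSetsType _ (@lebR R) R leb)) => t xy tT.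
have := xy _; rewrite /= in_itv/= => /(_ tT)[/eqP].
by rewrite powR_eq0 => /andP[/eqP/enorm_eq0/eqP + _]; rewrite subr_eq0 => /eqP.
Qed.

(** [Lp_gronwall] for w = |x| by means of |f(t, s, x, u)| <= K0 + K |x|. As K0 bounds the fields at
    x = 0 for every control value, the bound is uniform in u. *)
Lemma volterra_growth : exists2 C, 0 <= C &
  forall (x0 : 'rV[R]_n) u x, control T U u -> {within `[0, T], continuous x} ->
    {ae leb, forall t : R, 0 <= t <= T -> x t = volterra_map x0 u x t} ->
    (\int[leb]_(t in `[0%R, T]) (enorm (x t) `^ p)%:E
     <= (C * (1 + enorm x0) `^ p)%:E)%E.
Proof.
have [C C0 HC] := @Lp_gronwall R n T alpha p r K T0 alpha01 p1 r0 rp Kr.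
have [mK0 K0_ge0 K0fin] := K0r'.
have [q0 qr c0] := hoelder_exponent alpha_le1 r'0 r'a.
have [q0' qr' c0'] := hoelder_exponent (lexx 1) r'0 r'1.
have one q : q^-1 + r'^-1 = 1 -> (1 : R)^-1 = q^-1 + r'^-1 by rewrite invr1 => ->.
(* The case P = 1: A1 and A2 bound the integrals of the singular and regular kernels against K0,
   uniformly in t. *)
have [A1 A10 HA1] := kernel_mul_bound T0 c0 q0 r'0 ltr01 (one _ qr) mK0 K0_ge0 K0fin.
have [A2 A20 HA2] := kernel_mul_bound T0 c0' q0' r'0 ltr01 (one _ qr') mK0 K0_ge0 K0fin.
pose A := 1 + A1 + A2.
have A0 : 0 <= A by rewrite !addr_ge0.
exists (C * (A `^ p * T)); first by rewrite !mulr_ge0 ?powR_ge0.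
move=> x0 u x hu cx ex.
have [M M0 HM] := continuous_enorm_bounded T0 cx.
have a0 : 0 <= A * (1 + enorm x0) by rewrite mulr_ge0 ?addr_ge0 ?enorm_ge0.
apply: le_trans (HC (fun t => enorm (x t)) M (fun=> (A * (1 + enorm x0))%:E) _ _ _ _ _) _.
- exact: measurable_enorm_path.
- by move=> t tT; rewrite enorm_ge0 HM.
- exact: measurable_cst.
- by move=> t _; rewrite lee_fin.
- apply: (@filterS _ _ (@ae_filter_ringOfSetsType _ (@lebR R) R leb) _ _ _ ex) => t xt tT.
  have /andP[t0 tT'] := tT.
  have sT s : 0 <= s <= t -> 0 <= s <= T.
    by move=> /andP[-> st]; exact: le_trans tT'.
  have [ix1 ix2] := volterra_integrable cx hu tT.
  have mx := measurable_enorm_path cx tT'.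
  have H theta (h : R -> R -> 'rV[R]_n -> 'rV[R]_d -> 'rV[R]_n) A' i :
      controlled_field T U K0 K om h ->
      vintegrable `[0, t] (singular_integrand theta h x u t) ->
      (\int[leb]_(s in `[0%R, t]) (((t - s) `^ (theta - 1) * K0 s) `^ 1)%:E <= A'%:E)%E ->
      (`|vintegral `[0, t] (singular_integrand theta h x u t) ord0 i|%:E <= A'%:E +
        \int[leb]_(s in `[0%R, t]) ((t - s) `^ (theta - 1) * K s * enorm (x s))%:E)%E.
    move=> hh ih hA; rewrite mxE.
    have E : (\int[leb]_(s in `[0%R, t]) (((t - s) `^ (theta - 1) * K0 s) `^ 1)%:E
        = \int[leb]_(s in `[0%R, t]) ((t - s) `^ (theta - 1) * K0 s)%:E)%E.
      apply: eq_integral => s /set_mem/=; rewrite in_itv/= => st.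
      by rewrite powRr1// mulr_ge0 ?powR_ge0// K0_ge0// sT.
    rewrite E in hA; apply: le_trans (leeD2r _ hA).
    apply: normr_Rintegral_leD.
    - exact: ih.
    - apply: measurable_funM; first exact: measurable_kernel (measurable_itv _).
      by apply: measurable_funS mK0 => //; exact: subset_itv0.
    - exact: (measurable_kernelM mK theta tT mx).
    - by move=> s /sT sT'; rewrite mulr_ge0 ?powR_ge0// K0_ge0.
    - by move=> s /sT sT'; rewrite mulr_ge0 ?enorm_ge0// mulr_ge0 ?powR_ge0 ?K_ge0.
    - move=> s st; rewrite singular_integrandE normrM ger0_norm ?powR_ge0//.
      rewrite -mulrA -mulrDr ler_wpM2l ?powR_ge0//.
      have /andP[s0 st'] := st.
      by apply: (controlled_growth hh) => //; apply: hu.1; exact: sT.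
  have int0 theta : (0 <= \int[leb]_(s in `[0%R, t])
      ((t - s) `^ (theta - 1) * K s * enorm (x s))%:E)%E.
    apply: integral_ge0 => s /=; rewrite in_itv/= => /sT sT'.
    by rewrite lee_fin mulr_ge0 ?enorm_ge0// mulr_ge0 ?powR_ge0// K_ge0.
  apply: enorm_le_ecoord.
    apply: adde_ge0; first by rewrite lee_fin.
    by apply: adde_ge0; exact: int0.
  move=> i; have h1 := H _ _ _ i hf ix1 (HA1 t tT); have h2 := H _ _ _ i hg ix2 (HA2 t tT).
  rewrite xt//.
  (* The 1 in A makes the constant forcing A (1 + |x0|) dominate |x0| + A1 + A2. *)
  have aE : A1 + A2 + enorm x0 <= A * (1 + enorm x0).
    by rewrite /A; have := enorm_ge0 x0; nra.
  have aE' : ((enorm x0)%:E + (A1%:E + A2%:E) <= (A * (1 + enorm x0))%:E)%E.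
    by rewrite -!EFinD lee_fin; move: aE; rewrite [A1 + A2 + _]addrC.
  apply: le_trans (leeD2r _ aE').
  rewrite -addeA addeACA; apply: le_trans (leeD2l _ (leeD h1 h2)).
  rewrite -!EFinD lee_fin /volterra_map.
  move: (vintegral _ _) (vintegral _ _) => b a.
  rewrite !mxE -addrA; apply: le_trans (ler_normD _ _) _; apply: lerD.
    exact: normr_coord_le_enorm.
  exact: ler_normD.
have cst_pow : (\int[leb]_(s in `[0%R, T]) ((A * (1 + enorm x0))%:E `^ p)
    <= ((A * (1 + enorm x0)) `^ p * T)%:E)%E.
  apply: (@integral_powR_bound _ T p (A * (1 + enorm x0)) (fun=> A * (1 + enorm x0)) T0 (ltW p0)).
    exact: measurable_cst.
  by move=> s _; rewrite lexx a0.
apply: le_trans (lee_wpmul2l _ cst_pow) _; first by rewrite lee_fin.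
rewrite -EFinM lee_fin (powRM _ A0) ?addr_ge0 ?enorm_ge0//.
by rewrite le_eqVlt; apply/orP; left; apply/eqP; ring.
Qed.
End Equation.

(** * Verification of the hypotheses and assembly *)

Lemma regular_gapE (R : realType) (n d : nat) (T p : R)
    (g : R -> R -> 'rV[R]_n -> 'rV[R]_d -> 'rV[R]_n) x u u' :
  regular_gap T p g x u u'
  = ((\int[leb]_(t in `[0%R, T]) (gap 1 g x u u' t `^ p)) `^ p^-1)%E.
Proof.
congr (_ `^ _)%E; apply: eq_integral => t _; congr (_ `^ _)%E.
by apply: eq_integral => s _; rewrite subrr powRr0 divr1.
Qed.

Lemma satisfies_equationE (R : realType) (n d : nat) (alpha : R)
    (f g : R -> R -> 'rV[R]_n -> 'rV[R]_d -> 'rV[R]_n) x0 u x t :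
  satisfies_equation alpha f g x0 u x t <->
  [/\ vintegrable `[0, t] (singular_integrand alpha f x u t),
      vintegrable `[0, t] (singular_integrand 1 g x u t) &
      x t = volterra_map (alpha := alpha) (f := f) (g := g) x0 u x t].
Proof. by rewrite /satisfies_equation regular_integrandE. Qed.

Unset Implicit Arguments.
Theorem lemma2p1 (R : realType) (n d : nat) (T alpha p : R)
    (U : set 'rV[R]_d) (rho : 'rV[R]_d -> 'rV[R]_d -> R) (u0 : 'rV[R]_d)
    (f g : R -> R -> 'rV[R]_n -> 'rV[R]_d -> 'rV[R]_n)
    (hT : 0 < T) (halpha : 0 < alpha < 1) (hp : p > 1 / alpha)
    (hu0 : U u0)
    (hf : measurable_field T U f) (hg : measurable_field T U g)
    (hA1 : A1 U rho) (hA2 : A2 T U f g) (hA3 : A3 T alpha p U rho f g) :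
  ((forall (x0 : 'rV[R]_n) (u : R -> 'rV[R]_d), admissible T p U rho u0 u ->
      exists2 x : R -> 'rV[R]_n, is_solution T alpha f g x0 u x &
        forall y : R -> 'rV[R]_n, is_solution T alpha f g x0 u y ->
          forall t : R, 0 <= t <= T -> y t = x t)
   /\
   (exists2 C : R, 0 <= C &
      forall (x0 : 'rV[R]_n) (u : R -> 'rV[R]_d) (x : R -> 'rV[R]_n),
        admissible T p U rho u0 u -> is_solution T alpha f g x0 u x ->
        (Lpnorm T p (fun t => enorm (x t))
         <= C%:E * (1 + (enorm x0)%:E + Lpnorm T p (fun t => rho (u t) u0)))%E))
  /\
  (exists2 C : R, 0 <= C &
     forall (x0 x0' : 'rV[R]_n) (u u' : R -> 'rV[R]_d) (x x' : R -> 'rV[R]_n),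
       admissible T p U rho u0 u -> admissible T p U rho u0 u' ->
       is_solution T alpha f g x0 u x -> is_solution T alpha f g x0' u' x' ->
       (Lpnorm T p (fun t => enorm (x t - x' t))
        <= C%:E * (enorm (x0 - x0'))%:E
           + C%:E * singular_gap T alpha p f x u u'
           + C%:E * regular_gap T p g x u u')%E).
Proof.
have /andP[al0 al1] := halpha.
have T0 : 0 <= T by exact: ltW.
have p1 : 1 < p.
  apply: lt_trans hp; rewrite ltr_pdivlMr// mul1r; exact: al1.
have p0 : 0 < p by apply: lt_trans p1.
have [_ [K0 [K [K_ge0 [r1 hr1 K0r1] [r2 hr2 Kr2] lip zero]]]] := hA3.
have [L [omega [L0 [om_ge0 _ _ om_cvg] modu]]] := hA2.
(* Taking u = u' in (A3) then leaves the pure Lipschitz bound in x. *)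
have rho0 v : U v -> rho v v = 0 by move=> Uv; rewrite hA1.1// subrr enorm0.
pose om h := L * omega h.
have om0 h : 0 <= h -> 0 <= om h by move=> h0; rewrite mulr_ge0 ?om_ge0.
have omc : om h @[h --> 0^'+] --> (0 : R).
  by rewrite -[X in _ --> X](mulr0 L); apply: cvgM => //; exact: cvg_cst.
have ap1 : 0 < alpha * p - 1.
  by rewrite subr_gt0 mulrC -ltr_pdivrMr.
have r10 : 0 < r1 by apply: lt_trans hr1; rewrite divr_gt0.
have r20 : 0 < r2 by apply: lt_trans hr2; rewrite divr_gt0.
have r1al : r1^-1 < alpha.
  by rewrite -[ltRHS]invrK ltf_pV2 ?posrE ?invr_gt0// -[ltLHS]mul1r.
(* The exponent p / (alpha p - 1) in (A3) is the reciprocal of alpha - 1/p, so membership above it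
   is exactly this inequality. *)
have r2al : r2^-1 + p^-1 < alpha.
  rewrite -ltrBrDr; have -> : alpha - p^-1 = (p / (alpha * p - 1))^-1.
    by field; rewrite !gt_eqF.
  by rewrite ltf_pV2 ?posrE ?divr_gt0.
have K0n : nonneg_Lp T r1 K0.
  by apply: memLp_nonneg_Lp => //; [rewrite gt_eqF|move=> s /K_ge0[]].
have Kn : nonneg_Lp T r2 K.
  by apply: memLp_nonneg_Lp => //; [rewrite gt_eqF|move=> s /K_ge0[]].
(* A common exponent, still above 1/alpha, for K0 and K together in the continuity estimates; [r2]
   itself is kept for pairing K with L^p. *)
pose r := Num.min r1 r2.
have r0 : 0 < r by rewrite lt_min r10.
have ral : r^-1 < alpha.
  rewrite /r minEle; case: ifP => // _; apply: lt_trans r2al.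
  by rewrite ltrDl invr_gt0.
have K0r : nonneg_Lp T r K0.
  by apply: nonneg_Lp_le K0n => //; rewrite r0 ge_min lexx.
have Kr : nonneg_Lp T r K.
  by apply: nonneg_Lp_le Kn => //; rewrite r0 ge_min lexx orbT.
have cf : controlled_field T U K0 K om f.
  split => //.
  - move=> t s x x' u Dts Uu; have := lip t s x x' u u Dts Uu Uu.
    by rewrite rho0// addr0; apply: le_trans; rewrite lerDl enorm_ge0.
  - move=> t s u Dts Uu; apply: le_trans (zero t s u Dts Uu).
    by rewrite lerDl enorm_ge0.
  - move=> t t' s x u D1 D2 Uu; apply: le_trans (modu t t' s x u D1 D2 Uu).
    by rewrite lerDl enorm_ge0.
have cg : controlled_field T U K0 K om g.
  split => //.
  - move=> t s x x' u Dts Uu; have := lip t s x x' u u Dts Uu Uu.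
    by rewrite rho0// addr0; apply: le_trans; rewrite lerDr enorm_ge0.
  - move=> t s u Dts Uu; apply: le_trans (zero t s u Dts Uu).
    by rewrite lerDr enorm_ge0.
  - move=> t t' s x u D1 D2 Uu; apply: le_trans (modu t t' s x u D1 D2 Uu).
    by rewrite lerDr enorm_ge0.
have adm u : admissible T p U rho u0 u -> control T U u by case.
have sol x0 u x : is_solution T alpha f g x0 u x ->
    {within `[0, T], continuous x} /\
    {ae leb, forall t : R, 0 <= t <= T ->
      x t = volterra_map (alpha := alpha) (f := f) (g := g) x0 u x t}.
  move=> [cx ex]; split=> //.
  apply: (@filterS _ _ (@ae_filter_ringOfSetsType _ (@lebR R) R leb) _ _ _ ex).
  by move=> t + tT => /(_ tT)/satisfies_equationE[].
have exist := volterra_existence hT al0 (ltW al1) p1 r20 r2al Kn r0 ral K0r Kr om0 omc cf cg.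
have integ := volterra_integrable hT al0 (ltW al1) r0 ral K0r Kr om0 cf cg.
have uniq := volterra_uniqueness hT al0 (ltW al1) p1 r20 r2al Kn r0 ral K0r Kr om0 cf cg.
have [C1 C10 growth] :=
  volterra_growth hT al0 (ltW al1) p1 r20 r2al Kn r0 ral K0r Kr om0 cf cg.
have [C2 C20 stab] :=
  volterra_stability hT al0 (ltW al1) p1 r20 r2al Kn r0 ral K0r Kr om0 cf cg.
have ip : 0 < p^-1 by rewrite invr_gt0.
split; [split|].
- move=> x0 u /adm hu; have [x cx ex] := exist x0 u hu.
  have exx : {ae leb, forall t : R, 0 <= t <= T ->
      x t = volterra_map (alpha := alpha) (f := f) (g := g) x0 u x t} by exact: aeW.
  exists x => [|y /sol[cy ey]]; last exact: (uniq _ _ _ _ hu cy cx ey exx).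
  split => //; apply: aeW => t tT; apply/satisfies_equationE.
  by have [i1 i2] := integ x u cx hu t tT; split => //; exact: ex.
- exists (C1 `^ p^-1) => [|x0 u x /adm hu /sol[cx ex]]; first exact: powR_ge0.
  rewrite LpnormE ?gt_eqF//; last by move=> t _; exact: enorm_ge0.
  apply: le_trans (ge0_le_poweR (ltW ip) (ge0_integral_powR _ _ _) (growth _ _ _ hu cx ex)) _.
  rewrite poweR_EFin powRM ?powR_ge0// -powRrM mulfV ?gt_eqF//.
  rewrite powRr1 ?addr_ge0 ?enorm_ge0// EFinM lee_wpmul2l ?lee_fin ?powR_ge0//.
  by rewrite EFinD leeDl// Lnorm_ge0.
- pose M := C2 `^ p^-1 * (3 * 3 `^ p^-1).
  have M0 : 0 <= M by rewrite !mulr_ge0 ?powR_ge0.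
  (* The L^p norm of the constant |x0 - x0'| contributes the factor T^(1/p); the 1 covers the two
     gaps. *)
  exists (M * (1 + T `^ p^-1)); first by rewrite mulr_ge0// addr_ge0 ?powR_ge0.
  move=> x0 x0' u u' x x' /adm hu /adm hu' /sol[cx ex] /sol[cx' ex'].
  rewrite LpnormE ?gt_eqF//; last by move=> t _; exact: enorm_ge0.
  have := stab _ _ _ _ _ _ hu hu' cx cx' ex ex'.
  move=> /(ge0_le_poweR (ltW ip) (ge0_integral_powR _ _ _))/le_trans; apply.
  have mf := measurable_gap cf alpha cx hu hu'.
  have mg := measurable_gap cg 1 cx hu hu'.
  have : ((\int[leb]_(t in `[0%R, T]) (((enorm (x0 - x0'))%:E
          + (gap alpha f x u u' t + gap 1 g x u u' t)) `^ p)) `^ p^-1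
      <= (3 * 3 `^ p^-1)%:E * ((T `^ p^-1 * enorm (x0 - x0'))%:E
         + (singular_gap T alpha p f x u u' + regular_gap T p g x u u')))%E.
    rewrite regular_gapE.
    exact: (Lp_norm_add3_le T0 p0 (enorm_ge0 _) mf mg (gap_ge0 _ _ _ _ _) (gap_ge0 _ _ _ _ _)).
  have I0 : (0 <= \int[leb]_(t in `[0%R, T]) (((enorm (x0 - x0'))%:E
          + (gap alpha f x u u' t + gap 1 g x u u' t)) `^ p))%E.
    by apply: integral_ge0 => t _; exact: poweR_ge0.
  move: I0; set I := integral _ _ _ => I0.
  have sg0 : (0 <= singular_gap T alpha p f x u u')%E by exact: poweR_ge0.
  have rg0 : (0 <= regular_gap T p g x u u')%E by exact: poweR_ge0.
  move: (singular_gap _ _ _ _ _ _ _) (regular_gap _ _ _ _ _ _) sg0 rg0 => a b a0 b0 Iab.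
  rewrite poweRM ?lee_fin// poweR_EFin.
  apply: le_trans (lee_wpmul2l _ Iab) _; first by rewrite lee_fin powR_ge0.
  rewrite muleA -EFinM -/M.
  have t0 : 0 <= T `^ p^-1 by exact: powR_ge0.
  have e0 := enorm_ge0 (x0 - x0').
  have ab0 : (0 <= a + b)%E by exact: adde_ge0.
  rewrite ge0_muleDr ?lee_fin ?mulr_ge0// ge0_muleDr// addeA.
  have MM : M <= M * (1 + T `^ p^-1) by rewrite ler_peMr// lerDl.
  apply: leeD; [apply: leeD|].
  + rewrite -!EFinM lee_fin mulrA ler_wpM2r// ler_wpM2l//.
    by rewrite lerDr.
  + by rewrite lee_wpmul2r.
  + by rewrite lee_wpmul2r.
Qed.
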